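(* Let $\phi\in\mathbb{Q}(x)$ be a rational function of degree $2$ having a $2$-periodic critical point, and suppose that $\operatorname{Aut}(\phi)$ is trivial. Then there exists $v\in\mathbb{Q}\setminus\{0\}$ such that $\phi$ is linearly conjugate over $\mathbb{Q}$ to \[\phi_v:=\frac{v(x-1)}{x^2}.\] Moreover, for any such $v$ with $v\neq 3$: if $v\in\operatorname{Im}\eta$, then $G_{3,\phi}\cong C$; otherwise $G_{3,\phi}\cong(\mathbb{Z}/3\mathbb{Z})\wr S_2$.
   Context: The degree of a rational function $\phi=p/q$ with $p,q$ coprime polynomials is $\max\{\deg p,\deg q\}$; $\phi$ induces a map $\mathbb{P}^1(\overline{\mathbb{Q}})\to\mathbb{P}^1(\overline{\mathbb{Q}})$. A point $P$ is $n$-periodic if $\phi^n(P)=P$ and $n$ is the least such positive integer ($\phi^n$ = $n$-fold composition). A critical point is a point of $\mathbb{P}^1(\overline{\mathbb{Q}})$ at which the morphism $\phi:\mathbb{P}^1\to\mathbb{P}^1$ ramifies. Two rational functions $\phi,\psi\in\mathbb{Q}(x)$ are linearly conjugate over a field $K$ if $\psi=\sigma^{-1}\circ\phi\circ\sigma$ for some degree-one $\sigma\in K(x)$. $\operatorname{Aut}(\phi)$ is the group of degree-one $\sigma\in\overline{\mathbb{Q}}(x)$ with $\sigma^{-1}\circ\phi\circ\sigma=\phi$. The $3$rd dynatomic group $G_{3,\phi}$ is $\operatorname{Gal}(\mathbb{Q}_{3,\phi}/\mathbb{Q})$, where $\mathbb{Q}_{3,\phi}$ is the compositum of the fields of definition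 $\mathbb{Q}(P)$ of all $3$-periodic points $P\in\mathbb{P}^1(\overline{\mathbb{Q}})$ of $\phi$ (with $\mathbb{Q}(\infty)=\mathbb{Q}$). Let $\eta(t)=\dfrac{t^3+3t^2-6t+1}{t(t-1)}\in\mathbb{Q}(t)$ and $\operatorname{Im}\eta=\{\eta(u):u\in\mathbb{Q}\setminus\{0,1\}\}$. Let $C$ be the subgroup of the symmetric group $S_6$ generated by $(1,6)(2,4)(3,5)$ and $(1,2,3)(4,6,5)$ (it is isomorphic to $S_3$). The wreath product $(\mathbb{Z}/3\mathbb{Z})\wr S_2$ may be realized as the centralizer of $(1,2,3)(4,5,6)$ in $S_6$. *)

(* Defs.v *)
From HB Require Import structures.
From mathcomp Require Import all_boot all_order all_algebra all_fingroup all_field.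
Set Implicit Arguments. Unset Strict Implicit. Unset Printing Implicit Defensive.
Import GRing.Theory Num.Theory.
Local Open Scope ring_scope.

(* A rational function p/q over a field F, represented by the pair (p, q). *)
Definition rfun (F : fieldType) := ({poly F} * {poly F})%type.

Definition rdeg (F : fieldType) (phi : rfun F) : nat := maxn (size phi.1).-1 (size phi.2).-1.

Definition is_rfun (F : fieldType) (phi : rfun F) : bool := coprimep phi.1 phi.2 && (phi.2 != 0).

Definition ratC (phi : rfun rat) : rfun algC :=
  (map_poly ratr phi.1, map_poly ratr phi.2).

(* Points of P^1(F): Some a = a, None = infinity.
   Induced map P^1 -> P^1 (using the homogenisation of degree d = rdeg phi
   at infinity). *)
Definition rf_eval (F : fieldType) (phi : rfun F) (P : option F) : option F :=
  let p := phi.1 in let q := phi.2 in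
  match P with
  | Some a => if q.[a] != 0 then Some (p.[a] / q.[a]) else None
  | None => let d := rdeg phi in
            if q`_d != 0 then Some (p`_d / q`_d) else None
  end.

Definition is_periodic (T : eqType) (f : T -> T) (n : nat) (P : T) : Prop :=
  (0 < n)%N /\ iter n f P = P /\ (forall m, (0 < m < n)%N -> iter m f P <> P).

(* numerator of the derivative of u/v *)
Definition wr (F : fieldType) (u v : {poly F}) : {poly F} := u^`() * v - u * v^`().

Definition revd (F : fieldType) (d : nat) (p : {poly F}) : {poly F} := \poly_(i < d.+1) p`_(d - i).

(* P is a critical (ramification) point of phi: the derivative of phi in local
   coordinates (x or 1/x at the source, y or 1/y at the target) vanishes. *)
Definition is_critical (F : fieldType) (phi : rfun F) (P : option F) : Prop :=
  let p := phi.1 in let q := phi.2 in let d := rdeg phi in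
  match P with
  | Some a => if q.[a] != 0 then (wr p q).[a] = 0 else (wr q p).[a] = 0
  | None => let p' := revd d p in let q' := revd d q in
      if q'.[0] != 0 then (wr p' q').[0] = 0 else (wr q' p').[0] = 0
  end.

(* homogenised composition: numerator (or denominator) of phi((a x + b)/(c x + e)),
   multiplied by (c x + e)^d *)
Definition hom_comp (F : fieldType) (d : nat) (p : {poly F}) (a b c e : F) : {poly F} :=
  \sum_(i < d.+1) p`_i *: ((a *: 'X + b%:P) ^+ i * (c *: 'X + e%:P) ^+ (d - i)).

(* psi = sigma^{-1} o phi o sigma, sigma = (a x + b)/(c x + e), a e - b c <> 0,
   sigma^{-1} = (e y - b)/(- c y + a); equality of rational functions by
   cross-multiplication. *)
Definition lin_conj_by (F : fieldType) (phi psi : rfun F) (a b c e : F) : Prop :=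
  a * e - b * c != 0 /\
  let d := rdeg phi in
  let U := hom_comp d phi.1 a b c e in let V := hom_comp d phi.2 a b c e in
  psi.1 * (a *: V - c *: U) = psi.2 * (e *: U - b *: V).

Definition Qconj (phi psi : rfun rat) : Prop :=
  exists a b c e : rat, lin_conj_by phi psi a b c e.

Definition aut_trivial (phi : rfun algC) : Prop :=
  forall a b c e : algC, lin_conj_by phi phi a b c e -> b = 0 /\ c = 0 /\ a = e.

Definition phi_v (v : rat) : rfun rat := (v *: ('X - 1), 'X^2).

Definition in_eta (v : rat) : Prop :=
  exists u : rat, u != 0 /\ u != 1 /\
    v = (u ^+ 3 + 3 * u ^+ 2 - 6 * u + 1) / (u * (u - 1)).

(* K (a subfield of a splitting field L over Q, embedded into Qbar = algC by emb)
   is the compositum Q_{3,phi} of the fields Q(P), P a 3-periodic point of phi: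
   the smallest subfield whose image contains all finite 3-periodic points. *)
Definition is_Q3field (phi : rfun rat) (L : splittingFieldType rat)
    (emb : {rmorphism L -> algC}) (K : {subfield L}) : Prop :=
  let f := rf_eval (ratC phi) in
  (forall a : algC, is_periodic f 3 (Some a) -> exists2 x, x \in K & emb x = a) /\
  (forall E : {subfield L},
     (forall a : algC, is_periodic f 3 (Some a) -> exists2 x, x \in E & emb x = a) ->
     (K <= E)%VS).

(* Points 1..6 are the ordinals 0..5 of 'I_6. *)
Definition pt (i : nat) : 'I_6 := inord i.-1.

Definition gC1 : {perm 'I_6} := (tperm (pt 1) (pt 6) * tperm (pt 2) (pt 4) * tperm (pt 3) (pt 5))%g.
(* (1,2,3)(4,6,5); note (s * t) x = t (s x), and (a b c) = tperm a b * tperm a c *)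
Definition gC2 : {perm 'I_6} :=
  (tperm (pt 1) (pt 2) * tperm (pt 1) (pt 3) * (tperm (pt 4) (pt 6) * tperm (pt 4) (pt 5)))%g.
Definition Cgrp : {set {perm 'I_6}} := <<[set gC1; gC2]>>%g.

(* (1,2,3)(4,5,6) and the wreath product (Z/3) wr S_2 as its centralizer in S_6 *)
Definition gW : {perm 'I_6} :=
  (tperm (pt 1) (pt 2) * tperm (pt 1) (pt 3) * (tperm (pt 4) (pt 5) * tperm (pt 4) (pt 6)))%g.
Definition Wgrp : {set {perm 'I_6}} := 'C[gW]%g.

(* Main.v *)
Require Import Defs.
From HB Require Import structures.
From mathcomp Require Import all_boot all_order all_algebra all_fingroup all_field.
From mathcomp Require Import cyclic pgroup ring lra zify.
Set Implicit Arguments. Unset Strict Implicit. Unset Printing Implicit Defensive.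
Import Order.TTheory GRing.Theory Num.Theory.
Local Open Scope ring_scope.

(** Put the critical 2-cycle at (0, oo), with 0 critical: phi becomes (m x + n) / (d x ^ 2). If
    m = 0 this map commutes with multiplication by a cube root of unity; if m <> 0 it can be
    scaled to phi_v. Since (0, oo) is the only 2-cycle of phi_v and oo is not critical, every
    automorphism of algC fixes the critical point of phi, which is therefore rational.

    In the coordinate s = 1 / x the map phi_v is s |-> 1 / (v s (1 - s)), and on each of its
    3-cycles it agrees with a rotation s |-> 1 + w s, w a primitive cube root of unity. In the
    coordinate u = 1 - (1 - w) s, centred at the fixed point of this rotation, the points of
    period 3 are the roots of u ^ 3 = alpha := 1 - 3 (1 - w) / v. They generate Q(w, A, B) with
    A ^ 3 = alpha and B ^ 3 = conj alpha, whose Galois group over Q(w) depends on which of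
    alpha, conj alpha, alpha conj alpha and alpha / conj alpha are cubes in Q(w). A cube among
    the first three makes the norm (1 - 3 / v) ^ 3 + (3 / v) ^ 3 of alpha a rational cube, which
    Fermat's theorem for exponent 3 forbids when v <> 3; by Hilbert 90 the last one is a cube
    exactly when v is a value of eta. *)

(** * Binary forms *)

Lemma poly_sum_coef (R : nzRingType) n (p : {poly R}) : (size p <= n)%N ->
  p = \sum_(i < n) p`_i *: 'X^i.
Proof.
move=> sp; rewrite -poly_def; apply/polyP => i; rewrite coef_poly; case: ltnP => // le_ni.
by rewrite nth_default // (leq_trans sp).
Qed.

Section BinaryForms.
Variables (F R : comNzRingType) (f : {rmorphism F -> R}).
Implicit Types (p q : {poly F}) (x y k : R) (d m n : nat).

Definition homog d x y p : R := \sum_(i < d.+1) f p`_i * (x ^+ i * y ^+ (d - i)).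

Fact homog_is_linear d x y : linear_for (f \; *%R) (homog d x y).
Proof.
move=> a p q; rewrite /homog /= mulr_sumr -big_split /=; apply: eq_bigr => i _.
by rewrite coefD coefZ rmorphD rmorphM mulrDl -mulrA.
Qed.

HB.instance Definition _ d x y :=
  GRing.isLinear.Build F {poly F} R (f \; *%R) (homog d x y) (homog_is_linear d x y).

Lemma homog_scale d x y k p : homog d (k * x) (k * y) p = k ^+ d * homog d x y p.
Proof.
rewrite /homog mulr_sumr; apply: eq_bigr => i _.
have le_id : (i <= d)%N by rewrite -ltnS.
by rewrite !exprMn mulrACA -exprD subnKC //; ring.
Qed.

Lemma homogXn d x y i : (i <= d)%N -> homog d x y 'X^i = x ^+ i * y ^+ (d - i).
Proof.
move=> le_id; have lt_id : (i < d.+1)%N by [].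
rewrite /homog (bigD1 (Ordinal lt_id)) //= coefXn eqxx rmorph1 mul1r big1 ?addr0 // => j.
by rewrite -val_eqE coefXn /= => /negPf->; rewrite rmorph0 mul0r.
Qed.

Lemma homog_degree1 x y (a b : F) : homog 1 x y (a *: 'X + b%:P) = f a * x + f b * y.
Proof.
have homogX1 : homog 1 x y 'X = x by rewrite -[RHS]mulr1; exact: (homogXn x y (leqnn 1)).
have homog1 : homog 1 x y 1 = y by rewrite -[RHS]mul1r; exact: (homogXn x y (leq0n 1)).
by rewrite linearD -alg_polyC !linearZ_LR /= homogX1 homog1.
Qed.

Lemma homog_infty d p : homog d 1 0 p = f p`_d.
Proof.
rewrite /homog big_ord_recr big1 /=; last first.
  by move=> i _; rewrite expr0n subn_eq0 leqNgt ltn_ord /= !mulr0.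
by rewrite add0r subnn !expr1n !mulr1.
Qed.

Lemma homogM m n x y p q : (size p <= m.+1)%N -> (size q <= n.+1)%N ->
  homog (m + n) x y (p * q) = homog m x y p * homog n x y q.
Proof.
move=> /poly_sum_coef {1}-> /poly_sum_coef {1}->; rewrite mulr_suml linear_sum mulr_suml.
apply: eq_bigr => i _; rewrite mulr_sumr linear_sum mulr_sumr /=; apply: eq_bigr => j _.
have [le_im le_jn] : (i <= m)%N /\ (j <= n)%N by split; rewrite -ltnS.
rewrite -scalerAl -scalerAr -exprD !linearZ_LR /= !homogXn ?leq_add //.
have -> : (m + n - (i + j))%N = ((m - i) + (n - j))%N by lia.
by rewrite !exprD; ring.
Qed.

Lemma homogX n x y p : (size p <= 2)%N -> homog n x y (p ^+ n) = homog 1 x y p ^+ n.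
Proof.
move=> sp; elim: n => [|n IH]; first by rewrite !expr0 /homog big_ord1 coef1 rmorph1 !mulr1.
rewrite !exprS -add1n homogM ?IH // (leq_trans (size_poly_exp_leq _ _)) // ltnS.
by rewrite -{2}[n]mul1n leq_mul2r -subn1 leq_subLR sp orbT.
Qed.

End BinaryForms.

Lemma homog_horner (F : comNzRingType) d (p : {poly F}) x : (size p <= d.+1)%N ->
  homog idfun d x 1 p = p.[x].
Proof.
move=> sp; rewrite {2}(poly_sum_coef sp) horner_sum; apply: eq_bigr => i _.
by rewrite hornerZ hornerXn expr1n mulr1.
Qed.

Lemma hom_compE (F : fieldType) d (p : {poly F}) a b c e :
  hom_comp d p a b c e = homog polyC d (a *: 'X + b%:P) (c *: 'X + e%:P) p.
Proof. by apply: eq_bigr => i _; rewrite mul_polyC. Qed.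

Section LinearSubstitution.
Variable F : fieldType.
Implicit Types (p q : {poly F}) (a b c e k : F) (d : nat).

Lemma size_linear a b : (size (a *: 'X + b%:P)%R <= 2)%N.
Proof.
rewrite (leq_trans (size_polyD _ _)) // geq_max (leq_trans (size_scale_leq _ _)) ?size_polyX //.
by rewrite (leq_trans (size_polyC_leq1 b)).
Qed.

Lemma size_linear_exp a b n : (size ((a *: 'X + b%:P) ^+ n)%R <= n.+1)%N.
Proof.
apply: leq_trans (size_poly_exp_leq _ _) _.
by rewrite ltnS -{2}[n]mul1n leq_mul2r -subn1 leq_subLR size_linear orbT.
Qed.

Lemma size_hom_comp d p a b c e : (size (hom_comp d p a b c e) <= d.+1)%N.
Proof.
apply: leq_trans (size_sum _ _ _) _; apply/bigmax_leqP => i _.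
apply: leq_trans (size_scale_leq _ _) _; apply: leq_trans (size_polyMleq _ _) _.
have := size_linear_exp a b i; have := size_linear_exp c e (d - i); have := ltn_ord i.
by lia.
Qed.

Lemma hom_compZ d p k a b c e : hom_comp d (k *: p) a b c e = k *: hom_comp d p a b c e.
Proof. by rewrite !hom_compE linearZ_LR /= mul_polyC. Qed.

Lemma hom_compB d p q a b c e :
  hom_comp d (p - q) a b c e = hom_comp d p a b c e - hom_comp d q a b c e.
Proof. by rewrite !hom_compE linearB. Qed.

Lemma homog_hom_comp (R : comNzRingType) (f : {rmorphism F -> R}) d p a b c e x y :
  homog f d x y (hom_comp d p a b c e) = homog f d (f a * x + f b * y) (f c * x + f e * y) p.
Proof.
rewrite /hom_comp linear_sum; apply: eq_bigr => i _; rewrite linearZ_LR /=; congr (_ * _).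
have le_id : (i <= d)%N by rewrite -ltnS.
rewrite -{1}(subnKC le_id) homogM ?size_linear_exp //.
by rewrite (homogX _ i) ?(homogX _ (d - i)) ?size_linear // !homog_degree1.
Qed.

Lemma hom_comp_comp d p a b c e a' b' c' e' :
  hom_comp d (hom_comp d p a b c e) a' b' c' e' =
  hom_comp d p (a * a' + b * c') (a * b' + b * e') (c * a' + e * c') (c * b' + e * e').
Proof.
rewrite [LHS]hom_compE homog_hom_comp [RHS]hom_compE -!mul_polyC !polyCD !polyCM.
by congr homog; ring.
Qed.

Lemma hom_comp_scalar d p k : (size p <= d.+1)%N -> hom_comp d p k 0 0 k = k ^+ d *: p.
Proof.
move=> sp; rewrite hom_compE scale0r add0r addr0 -mul_polyC -{2}[k%:P]mulr1 homog_scale.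
rewrite -polyC_exp mul_polyC {2}(poly_sum_coef sp).
congr (_ *: _); apply: eq_bigr => i _.
by rewrite expr1n mulr1 mul_polyC.
Qed.

End LinearSubstitution.

(** * Rational functions on the projective line *)

Definition proj_pt (F : fieldType) (x y : F) : option F :=
  if y == 0 then None else Some (x / y).

Definition ptx (F : fieldType) (P : option F) : F := if P is Some a then a else 1.
Definition pty (F : fieldType) (P : option F) : F := if P is Some _ then 1 else 0.

Definition moebius (F : fieldType) (a b c e : F) (P : option F) : option F :=
  proj_pt (a * ptx P + b * pty P) (c * ptx P + e * pty P).

Section ProjectiveLine.
Variable F : fieldType.
Implicit Types (x y k a b c e : F) (P Q : option F).

Lemma proj_ptK P : proj_pt (ptx P) (pty P) = P.
Proof. by case: P => [a|]; rewrite /proj_pt /= ?eqxx // oner_eq0 divr1. Qed.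

Lemma pt_neq0 P : (ptx P != 0) || (pty P != 0).
Proof. by case: P => [a|] /=; rewrite oner_eq0 ?orbT. Qed.

Lemma proj_ptZ k x y : k != 0 -> proj_pt (k * x) (k * y) = proj_pt x y.
Proof.
move=> k0; rewrite /proj_pt mulf_eq0 (negPf k0) /=.
by case: eqP => // /eqP y0; rewrite invfM mulrACA divff // mul1r.
Qed.

Lemma proj_ptP x y : (x != 0) || (y != 0) ->
  exists2 k, k != 0 & x = k * ptx (proj_pt x y) /\ y = k * pty (proj_pt x y).
Proof.
rewrite /proj_pt; case: (eqVneq y 0) => [->|y0]; rewrite ?orbF => xy0.
  by exists x; rewrite //= mulr1 mulr0.
by exists y; rewrite //= mulr1 mulrC divfK.
Qed.

Lemma linear_neq0 a b c e x y : a * e - b * c != 0 -> (x != 0) || (y != 0) ->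
  (a * x + b * y != 0) || (c * x + e * y != 0).
Proof.
move=> det; apply: contraTT; rewrite !negb_or !negbK => /andP[/eqP ax_by /eqP cx_ey].
have det_x : (a * e - b * c) * x = e * (a * x + b * y) - b * (c * x + e * y) by ring.
have det_y : (a * e - b * c) * y = a * (c * x + e * y) - c * (a * x + b * y) by ring.
move/eqP: det_x; move/eqP: det_y; rewrite ax_by cx_ey !mulr0 subrr !mulf_eq0 (negPf det) /=.
by move=> -> ->.
Qed.

Lemma moebius_proj a b c e x y : (x != 0) || (y != 0) ->
  moebius a b c e (proj_pt x y) = proj_pt (a * x + b * y) (c * x + e * y).
Proof.
move=> xy0; have [k k0 [xE yE]] := proj_ptP xy0.
rewrite /moebius; move: (proj_pt x y) xE yE => P -> ->.
by rewrite !(mulrCA _ k) -!mulrDr proj_ptZ.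
Qed.

Lemma moebiusK a b c e : a * e - b * c != 0 ->
  cancel (moebius a b c e) (moebius e (- b) (- c) a).
Proof.
move=> det P; rewrite {2}/moebius moebius_proj ?linear_neq0 ?pt_neq0 //.
rewrite -[RHS]proj_ptK -[RHS](proj_ptZ _ _ det).
by congr proj_pt; ring.
Qed.

Lemma moebiusVK a b c e : a * e - b * c != 0 ->
  cancel (moebius e (- b) (- c) a) (moebius a b c e).
Proof.
move=> det; rewrite -{2}(opprK b) -{2}(opprK c); apply: moebiusK.
by rewrite mulrNN mulrC.
Qed.

End ProjectiveLine.

Definition rf_num (F : fieldType) (phi : rfun F) (x y : F) : F :=
  homog idfun (rdeg phi) x y phi.1.
Definition rf_den (F : fieldType) (phi : rfun F) (x y : F) : F :=
  homog idfun (rdeg phi) x y phi.2.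

Definition scale_rfun (F : fieldType) (k : F) (phi : rfun F) : rfun F :=
  (k *: phi.1, k *: phi.2).

(* sigma^-1 o phi o sigma for sigma = (a x + b) / (c x + e), with the adjugate for sigma^-1 *)
Definition conj_rfun (F : fieldType) (phi : rfun F) (a b c e : F) : rfun F :=
  let U := hom_comp (rdeg phi) phi.1 a b c e in let V := hom_comp (rdeg phi) phi.2 a b c e in
  (e *: U - b *: V, a *: V - c *: U).

Section RationalFunctions.
Variable F : fieldType.
Implicit Types (phi psi : rfun F) (P : option F) (a b c e k x y : F).

Lemma size_rf_num phi : (size phi.1 <= (rdeg phi).+1)%N.
Proof. by rewrite /rdeg; lia. Qed.

Lemma size_rf_den phi : (size phi.2 <= (rdeg phi).+1)%N.
Proof. by rewrite /rdeg; lia. Qed.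

Lemma rdeg_coef_neq0 phi : is_rfun phi -> (phi.1`_(rdeg phi) != 0) || (phi.2`_(rdeg phi) != 0).
Proof.
move=> /andP[_ q0]; rewrite /rdeg; case: (leqP (size phi.1).-1 (size phi.2).-1) => [_|lt_qp].
  by rewrite -/(lead_coef phi.2) lead_coef_eq0 q0 orbT.
rewrite -/(lead_coef phi.1) lead_coef_eq0.
by case: eqVneq lt_qp => // ->; rewrite size_poly0.
Qed.

Lemma rf_eval_proj phi x y : (x != 0) || (y != 0) ->
  rf_eval phi (proj_pt x y) = proj_pt (rf_num phi x y) (rf_den phi x y).
Proof.
move=> xy0; have [k k0 [xE yE]] := proj_ptP xy0.
move: (proj_pt x y) xE yE => P -> ->; rewrite /rf_num /rf_den !homog_scale proj_ptZ ?expf_neq0 //.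
case: P => [a|] /=; rewrite /proj_pt ?homog_infty ?if_neg //.
by rewrite !homog_horner ?size_rf_num ?size_rf_den.
Qed.

Lemma rf_forms_neq0 phi x y : is_rfun phi -> (x != 0) || (y != 0) ->
  (rf_num phi x y != 0) || (rf_den phi x y != 0).
Proof.
move=> rf xy0; have [k k0 [xE yE]] := proj_ptP xy0.
move: (proj_pt x y) xE yE => P -> ->; rewrite /rf_num /rf_den !homog_scale !(mulf_eq0 (k ^+ _)).
rewrite !(negPf (expf_neq0 _ k0)) /=.
case: P => [a|] /=; last by rewrite !homog_infty rdeg_coef_neq0.
rewrite !homog_horner ?size_rf_num ?size_rf_den //.
case/andP: rf => cpq _; case: (eqVneq phi.1.[a] 0) => //= pa.
by have := coprimep_root cpq (introT eqP pa : root phi.1 a).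
Qed.

Lemma rdeg_scale k phi : k != 0 -> rdeg (scale_rfun k phi) = rdeg phi.
Proof. by move=> k0; rewrite /rdeg /= !size_scale. Qed.

Lemma rf_eval_scale k phi P : k != 0 -> rf_eval (scale_rfun k phi) P = rf_eval phi P.
Proof.
move=> k0; rewrite -(proj_ptK P) !rf_eval_proj ?pt_neq0 // /rf_num /rf_den rdeg_scale //.
by rewrite !linearZ_LR proj_ptZ.
Qed.

Lemma ltn_size_coef (p : {poly F}) d : p`_d != 0 -> (d < size p)%N.
Proof. by rewrite ltnNge; apply: contra => /(nth_default 0)->. Qed.

Lemma rdeg_eq phi d : (size phi.1 <= d.+1)%N -> (size phi.2 <= d.+1)%N ->
  (phi.1`_d != 0) || (phi.2`_d != 0) -> rdeg phi = d.
Proof.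
by rewrite /rdeg => sp sq /orP[] /ltn_size_coef; lia.
Qed.

Lemma conj_rfun_scale k phi a b c e : k != 0 ->
  conj_rfun (scale_rfun k phi) a b c e = scale_rfun k (conj_rfun phi a b c e).
Proof.
move=> k0; rewrite /conj_rfun rdeg_scale // /scale_rfun /= !hom_compZ !scalerBr !scalerA.
by rewrite ![k * _]mulrC.
Qed.

Lemma conj_rfun_scalar k phi :
  conj_rfun phi k 0 0 k = scale_rfun (k ^+ (rdeg phi).+1) phi.
Proof.
rewrite /conj_rfun !hom_comp_scalar ?size_rf_num ?size_rf_den // !scale0r !subr0 !scalerA.
by rewrite -!exprS.
Qed.

Section Conjugation.
Variables (phi : rfun F) (a b c e : F).
Hypotheses (rf : is_rfun phi) (det : a * e - b * c != 0).

Let adj_det : e * a - - b * - c != 0.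
Proof. by rewrite mulrNN mulrC. Qed.

Lemma conj_rfun_coef_neq0 : ((conj_rfun phi a b c e).1`_(rdeg phi) != 0)
  || ((conj_rfun phi a b c e).2`_(rdeg phi) != 0).
Proof.
have leadE (p : {poly F}) : p`_(rdeg phi) = homog idfun (rdeg phi) 1 0 p by rewrite homog_infty.
rewrite !leadE !linearB !linearZ_LR /= !homog_hom_comp /= [a * _ - _]addrC -!mulNr.
by apply: linear_neq0 => //; apply/rf_forms_neq0/linear_neq0; rewrite // oner_eq0.
Qed.

Lemma rdeg_conj : rdeg (conj_rfun phi a b c e) = rdeg phi.
Proof.
have size_comb (k l : F) (p q : {poly F}) n : (size p <= n)%N -> (size q <= n)%N ->
    (size (k *: p - l *: q)%R <= n)%N.
  move=> sp sq; apply: leq_trans (size_polyD _ _) _.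
  by rewrite geq_max size_polyN !(leq_trans (size_scale_leq _ _)).
by apply: rdeg_eq conj_rfun_coef_neq0; rewrite size_comb ?size_hom_comp.
Qed.

Lemma rf_num_conj x y : rf_num (conj_rfun phi a b c e) x y =
  e * rf_num phi (a * x + b * y) (c * x + e * y) - b * rf_den phi (a * x + b * y) (c * x + e * y).
Proof. by rewrite /rf_num rdeg_conj linearB !linearZ_LR /= !homog_hom_comp. Qed.

Lemma rf_den_conj x y : rf_den (conj_rfun phi a b c e) x y =
  a * rf_den phi (a * x + b * y) (c * x + e * y) - c * rf_num phi (a * x + b * y) (c * x + e * y).
Proof. by rewrite /rf_den rdeg_conj linearB !linearZ_LR /= !homog_hom_comp. Qed.

Lemma rf_forms_conj_neq0 x y : (x != 0) || (y != 0) ->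
  (rf_num (conj_rfun phi a b c e) x y != 0) || (rf_den (conj_rfun phi a b c e) x y != 0).
Proof.
move=> xy0; rewrite rf_num_conj rf_den_conj [a * _ - _]addrC -!mulNr.
by apply: linear_neq0 => //; apply/rf_forms_neq0/linear_neq0.
Qed.

Lemma rf_eval_conj P :
  rf_eval phi (moebius a b c e P) = moebius a b c e (rf_eval (conj_rfun phi a b c e) P).
Proof.
have P0 := pt_neq0 P; rewrite -[LHS](moebiusVK det); congr moebius.
rewrite -{2}(proj_ptK P) {2}/moebius !rf_eval_proj ?linear_neq0 //.
rewrite moebius_proj ?rf_forms_neq0 ?linear_neq0 // rf_num_conj rf_den_conj.
by rewrite !mulNr [- _ + _]addrC.
Qed.

Lemma conj_rfun_comp a' b' c' e' :
  conj_rfun (conj_rfun phi a b c e) a' b' c' e' =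
  conj_rfun phi (a * a' + b * c') (a * b' + b * e') (c * a' + e * c') (c * b' + e * e').
Proof.
rewrite {1}/conj_rfun rdeg_conj /= !hom_compB !hom_compZ !hom_comp_comp -!mul_polyC.
by rewrite /conj_rfun -!mul_polyC !polyCD !polyCM; congr (_, _); ring.
Qed.

Lemma conj_rfun_lin_conj psi k :
  conj_rfun phi a b c e = scale_rfun k psi -> lin_conj_by phi psi a b c e.
Proof.
move=> conjE; split=> //=; have /= -> := congr1 snd conjE; have /= -> := congr1 fst conjE.
by rewrite -!scalerAr mulrC.
Qed.

Lemma lin_conj_conj_rfun psi : is_rfun psi -> rdeg psi = rdeg phi ->
  lin_conj_by phi psi a b c e ->
  exists2 k, k != 0 & conj_rfun phi a b c e = scale_rfun k psi.
Proof.
move=> rf_psi deg [_ UV]; have := conj_rfun_coef_neq0; have := rdeg_conj; rewrite -deg.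
set U := conj_rfun _ _ _ _ _ => degU leadU; have {}UV : psi.1 * U.2 = psi.2 * U.1 := UV.
move: U UV degU leadU => U UV degU leadU.
have /andP[cop den0] := rf_psi; have [r denE] : exists r : {poly F}, U.2 = r * psi.2.
  rewrite coprimep_sym in cop.
  by apply/dvdpP; rewrite -(Gauss_dvdpr _ cop) UV dvdp_mulr.
have numE : U.1 = r * psi.1 by apply: (mulfI den0); rewrite -UV denE; ring.
have r0 : r != 0.
  by apply: contraTneq leadU => r0; rewrite numE denE r0 !mul0r !coef0 eqxx.
have size_r : (size r <= 1)%N.
  have size_factor (p : {poly F}) : p`_(rdeg psi) != 0 ->
      (size (r * p)%R <= (rdeg psi).+1)%N -> (size r <= 1)%N.
    move=> /ltn_size_coef lt_p; have p0 : p != 0 by rewrite -size_poly_gt0 (leq_ltn_trans _ lt_p).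
    by rewrite size_mul //; move: (size r) (size p) (rdeg psi) lt_p; clear; lia.
  have := size_rf_num U; have := size_rf_den U; rewrite degU numE denE.
  by case/orP: (rdeg_coef_neq0 rf_psi) => /size_factor; auto.
exists r`_0; first by rewrite -polyC_eq0 -size1_polyC.
by rewrite [U]surjective_pairing numE denE (size1_polyC size_r) !mul_polyC coefC.
Qed.

End Conjugation.

Lemma rf_eval_lin_conj phi psi a b c e P :
  is_rfun phi -> is_rfun psi -> rdeg psi = rdeg phi -> lin_conj_by phi psi a b c e ->
  rf_eval phi (moebius a b c e P) = moebius a b c e (rf_eval psi P).
Proof.
move=> rf rf_psi deg lc; have det := proj1 lc; rewrite rf_eval_conj //.
by have [k k0 ->] := lin_conj_conj_rfun rf det rf_psi deg lc; rewrite rf_eval_scale.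
Qed.

(* If rho commutes with the conjugate of phi by sigma, then sigma rho sigma^-1 commutes with phi. *)
Lemma lin_conj_by_aut phi a b c e a' b' c' e' k :
  let A := a * a' + b * c' in let B := a * b' + b * e' in
  let C := c * a' + e * c' in let E := c * b' + e * e' in
  is_rfun phi -> a * e - b * c != 0 -> a' * e' - b' * c' != 0 -> k != 0 ->
  conj_rfun (conj_rfun phi a b c e) a' b' c' e' = scale_rfun k (conj_rfun phi a b c e) ->
  lin_conj_by phi phi (A * e - B * c) (B * a - A * b) (C * e - E * c) (E * a - C * b).
Proof.
move=> A B C E rf det det' k0; rewrite conj_rfun_comp // -/A -/B -/C -/E => conjE.
have detAE : A * E - B * C = (a * e - b * c) * (a' * e' - b' * c') by rewrite /A /B /C /E; ring.
pose D := a * e - b * c; apply: (@conj_rfun_lin_conj phi _ _ _ _ _ phi (k * D ^+ (rdeg phi).+1)).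
  have -> : (A * e - B * c) * (E * a - C * b) - (B * a - A * b) * (C * e - E * c) =
    (A * E - B * C) * (a * e - b * c) by ring.
  by rewrite detAE !mulf_neq0.
transitivity (conj_rfun (conj_rfun phi A B C E) e (- b) (- c) a).
  by rewrite conj_rfun_comp // ?detAE ?mulf_neq0 //; congr conj_rfun; ring.
rewrite conjE conj_rfun_scale // conj_rfun_comp //.
transitivity (scale_rfun k (conj_rfun phi D 0 0 D)).
  by congr (scale_rfun k (conj_rfun _ _ _ _ _)); rewrite /D; ring.
by rewrite conj_rfun_scalar /scale_rfun /= !scalerA.
Qed.

End RationalFunctions.

(** * Quadratic maps with a critical 2-cycle *)

Definition jacobian2 (F : fieldType) (phi : rfun F) (x y : F) : F :=
  let p := phi.1 in let q := phi.2 in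
  (p`_2 * q`_1 - p`_1 * q`_2) * x ^+ 2 + (p`_2 * q`_0 - p`_0 * q`_2) * (x * y) *+ 2
  + (p`_1 * q`_0 - p`_0 * q`_1) * y ^+ 2.

Section Critical.
Variable F : fieldType.
Implicit Types (phi : rfun F) (p q : {poly F}) (P : option F) (a b c e x y k : F).

Lemma poly_deg2 p : (size p <= 3)%N -> p = p`_2 *: 'X^2 + p`_1 *: 'X + (p`_0)%:P.
Proof.
move=> /poly_sum_coef {1}->.
by rewrite !big_ord_recr big_ord0 /= add0r expr0 alg_polyC addrC [_%:P + _]addrC addrA.
Qed.

Lemma wr_antisym p q : wr q p = - wr p q.
Proof. by rewrite /wr; ring. Qed.

Lemma wr_deg2 p q x : (size p <= 3)%N -> (size q <= 3)%N ->
  (wr p q).[x] = jacobian2 (p, q) x 1.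
Proof.
move=> /poly_deg2 pE /poly_deg2 qE; rewrite /wr {1 2}pE {1 2}qE.
rewrite !(derivD, derivZ, derivXn, derivX, derivC) /=.
rewrite !(hornerD, hornerN, hornerM, hornerMn, hornerZ, hornerXn, hornerX, hornerC).
by rewrite /jacobian2 /=; ring.
Qed.

Lemma is_criticalE phi P : rdeg phi = 2%N ->
  is_critical phi P <-> jacobian2 phi (ptx P) (pty P) = 0.
Proof.
move=> deg2; have [size_num size_den] : (size phi.1 <= 3)%N /\ (size phi.2 <= 3)%N.
  by rewrite -deg2 size_rf_num size_rf_den.
have wr_eq0 (b : bool) (p q : {poly F}) x :
    (if b then (wr p q).[x] = 0 else (wr q p).[x] = 0) <-> (wr p q).[x] = 0.
  case: b => //; rewrite (wr_antisym p) hornerN.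
  by split=> [/eqP | ->]; rewrite ?oppr0 // oppr_eq0 => /eqP.
rewrite /is_critical; case: P => [x|]; rewrite wr_eq0.
  by rewrite wr_deg2.
rewrite deg2 wr_deg2 ?size_poly //.
have -> : jacobian2 (revd 2 phi.1, revd 2 phi.2) 0 1 = - jacobian2 phi 1 0.
  by rewrite /jacobian2 /= !coef_poly /=; ring.
by split=> [/eqP | ->]; rewrite ?oppr0 // oppr_eq0 => /eqP.
Qed.

Lemma coef_hom_comp2 p a b c e i : (hom_comp 2 p a b c e)`_i =
  nth 0 [:: p`_2 * b ^+ 2 + p`_1 * (b * e) + p`_0 * e ^+ 2;
            p`_2 * (a * b) *+ 2 + p`_1 * (a * e + b * c) + p`_0 * (c * e) *+ 2;
            p`_2 * a ^+ 2 + p`_1 * (a * c) + p`_0 * c ^+ 2] i.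
Proof.
set A := (X in [:: X; _; _]); set B := (X in [:: _; X; _]); set C := (X in [:: _; _; X]).
have -> : hom_comp 2 p a b c e = C%:P * 'X^2 + B%:P * 'X + A%:P.
  rewrite /hom_comp !big_ord_recr big_ord0 /= -!mul_polyC !expr1 !expr0.
  by rewrite /A /B /C add0r; ring.
rewrite !(coefD, coefCM, coefXn, coefX, coefC).
by case: i => [|[|[|i]]]; rewrite /= ?nth_nil; ring.
Qed.

Lemma jacobian2_conj phi a b c e x y : rdeg phi = 2%N ->
  jacobian2 (conj_rfun phi a b c e) x y =
  (a * e - b * c) ^+ 2 * jacobian2 phi (a * x + b * y) (c * x + e * y).
Proof.
move=> deg2; rewrite /conj_rfun deg2 /jacobian2 /= !(coefB, coefZ) !coef_hom_comp2 /=.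
ring.
Qed.

Lemma is_critical_conj phi a b c e P : is_rfun phi -> rdeg phi = 2%N -> a * e - b * c != 0 ->
  is_critical (conj_rfun phi a b c e) P <-> is_critical phi (moebius a b c e P).
Proof.
move=> rf deg2 det; have deg2' : rdeg (conj_rfun phi a b c e) = 2%N by rewrite rdeg_conj.
rewrite !is_criticalE // jacobian2_conj // /moebius.
have [k k0 [xE yE]] := proj_ptP (linear_neq0 det (pt_neq0 P)).
move: (proj_pt _ _) xE yE => Q -> ->; set x := ptx _; set y := pty _.
rewrite (_ : jacobian2 phi _ _ = k ^+ 2 * jacobian2 phi x y); last by rewrite /jacobian2; ring.
rewrite mulrA -exprMn; split=> [/eqP | ->]; last by rewrite mulr0.
by rewrite mulf_eq0 expf_eq0 mulf_eq0 (negPf det) (negPf k0) => /eqP.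
Qed.

End Critical.

Definition linear_over_square (F : fieldType) (m n d : F) : rfun F :=
  (m *: 'X + n%:P, d *: 'X^2).

Definition phi_normal (F : fieldType) (v : F) : rfun F := (v *: ('X - 1), 'X^2).

Section NormalForm.
Variable F : fieldType.
Implicit Types (phi : rfun F) (P : option F) (m n d k v x : F).

Lemma rdeg_linear_over_square m n d : d != 0 -> rdeg (linear_over_square m n d) = 2%N.
Proof.
move=> d0; rewrite /rdeg /= size_scale // size_polyXn.
by have := size_linear m n; move: (size _); clear; lia.
Qed.

Lemma conj_linear_over_square m n d k : d != 0 ->
  conj_rfun (linear_over_square m n d) k 0 0 1 = linear_over_square (k * m) n (k ^+ 3 * d).
Proof.
move=> d0; rewrite /conj_rfun rdeg_linear_over_square // !scale1r !scale0r !subr0 /=.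
congr (_, _); apply/polyP => i; rewrite ?coefZ coef_hom_comp2;
  rewrite !(coefD, coefZ, coefXn, coefX, coefC) /=;
  by case: i => [|[|[|i]]]; rewrite /= ?nth_nil; ring.
Qed.

Lemma linear_over_square_normal n d : d != 0 ->
  linear_over_square (- n) n d = scale_rfun d (phi_normal (- n / d)).
Proof.
move=> d0; rewrite /scale_rfun /linear_over_square /= scalerA mulrC divfK //.
by rewrite scalerBr !scaleNr opprK alg_polyC.
Qed.

Lemma rdeg_normal v : v != 0 -> rdeg (phi_normal v) = 2%N.
Proof. by move=> v0; rewrite /rdeg /= size_polyXn size_scale // size_XsubC. Qed.

Lemma is_rfun_normal v : v != 0 -> is_rfun (phi_normal v).
Proof.
move=> v0; rewrite /is_rfun /= -size_poly_gt0 size_polyXn andbT coprimepZl // coprimep_expr //.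
by rewrite coprimepX rootE hornerD hornerN hornerX hornerC sub0r oppr_eq0 oner_eq0.
Qed.

Lemma rf_eval_normal0 v : rf_eval (phi_normal v) (Some 0) = None.
Proof. by rewrite /= hornerXn expr0n eqxx. Qed.

Lemma rf_eval_normal_infty v : v != 0 -> rf_eval (phi_normal v) None = Some 0.
Proof.
move=> v0; rewrite /= rdeg_normal // coefXn oner_eq0 /= coefZ coefB coefX coef1 /=.
by rewrite subr0 mulr0 mul0r.
Qed.

Lemma rf_eval_normal v x : x != 0 ->
  rf_eval (phi_normal v) (Some x) = Some (v * (x - 1) / x ^+ 2).
Proof.
by move=> x0; rewrite /= hornerXn expf_neq0 // hornerZ hornerD hornerN hornerX hornerC.
Qed.

(* Points x, y <> 0 forming a 2-cycle satisfy y x ^ 2 = v (x - 1) and x y ^ 2 = v (y - 1);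
   subtracting, x y = v, and then v = 0. *)
Lemma period2_normal v P : v != 0 ->
  is_periodic (rf_eval (phi_normal v)) 2 P -> P = Some 0 \/ P = None.
Proof.
move=> v0 [_ [/= cycle fix_n]]; case: P cycle fix_n => [x|]; last by right.
have [-> | x0] := eqVneq x 0; first by left.
pose y := v * (x - 1) / x ^+ 2; have fx : rf_eval (phi_normal v) (Some x) = Some y.
  exact: rf_eval_normal.
rewrite fx; have [-> | y0] := eqVneq y 0; first by rewrite rf_eval_normal0.
rewrite (rf_eval_normal v y0) => -[yx] fix_n.
have xy : x != y by apply/eqP => xy; case: (fix_n 1%N isT); rewrite [iter _ _ _]fx -xy.
have Ey : y * x ^+ 2 = v * (x - 1) by rewrite divfK // expf_neq0.
have Ex : x * y ^+ 2 = v * (y - 1) by rewrite -{1}yx divfK // expf_neq0.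
have Exy : x * y = v.
  apply: (mulfI (_ : x - y != 0)); first by rewrite subr_eq0.
  transitivity (y * x ^+ 2 - x * y ^+ 2); first by ring.
  by rewrite Ey Ex; ring.
case/eqP: v0; transitivity (v * y - x * y ^+ 2); first by rewrite Ex; ring.
by rewrite -Exy; ring.
Qed.

Lemma critical_swap_form phi : rdeg phi = 2%N -> phi.1.[0] != 0 ->
  rf_eval phi (Some 0) = None -> rf_eval phi None = Some 0 -> is_critical phi (Some 0) ->
  exists m n d, [/\ phi = linear_over_square m n d, n != 0, d != 0
    & m = 0 <-> is_critical phi None].
Proof.
move=> deg2; rewrite horner_coef0 => num0 eval0 eval_infty crit0.
have [/poly_deg2 numE /poly_deg2 denE] : (size phi.1 <= 3)%N /\ (size phi.2 <= 3)%N.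
  by rewrite -deg2 size_rf_num size_rf_den.
have den0 : phi.2`_0 = 0 by move: eval0; rewrite /= horner_coef0; case: eqP.
have [num2 den2] : phi.1`_2 = 0 /\ phi.2`_2 != 0.
  move: eval_infty; rewrite /= deg2; case: ifP => // den2 [] /eqP.
  by rewrite mulf_eq0 invr_eq0 (negPf den2) orbF => /eqP.
have den1 : phi.2`_1 = 0.
  move/(is_criticalE _ deg2): crit0; rewrite (_ : jacobian2 _ _ _ = - (phi.1`_0 * phi.2`_1)).
    by move/eqP; rewrite oppr_eq0 mulf_eq0 (negPf num0) => /eqP.
  by rewrite /jacobian2 /= den0; ring.
exists phi.1`_1, phi.1`_0, phi.2`_2; split=> //.
  rewrite /linear_over_square [LHS]surjective_pairing [in LHS]numE [in LHS]denE num2 den1 den0.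
  by rewrite !scale0r !add0r !addr0.
rewrite is_criticalE // (_ : jacobian2 _ _ _ = - (phi.1`_1 * phi.2`_2)); last first.
  by rewrite /jacobian2 /= num2; ring.
split=> [->|/eqP]; first by rewrite mul0r oppr0.
by rewrite oppr_eq0 mulf_eq0 (negPf den2) orbF => /eqP.
Qed.

(* sigma = (a x + b) / (c x + e) sends 0 to P and infinity to Q. *)
Lemma critical_cycle_form phi P : is_rfun phi -> rdeg phi = 2%N -> is_critical phi P ->
  is_periodic (rf_eval phi) 2 P ->
  let Q := rf_eval phi P in let a := ptx Q in let b := ptx P in let c := pty Q in let e := pty P in
  a * e - b * c != 0 /\ exists m n d,
    [/\ conj_rfun phi a b c e = linear_over_square m n d, n != 0, d != 0
      & m = 0 <-> is_critical phi Q].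
Proof.
move=> rf deg2 crit [_ [cycle fix_n]] Q a b c e; have {}cycle : rf_eval phi Q = P := cycle.
have det : a * e - b * c != 0.
  apply: contra_not_neq (fix_n 1%N isT) => /= det0; rewrite -/Q.
  move: det0; rewrite /a /b /c /e; case: (Q) (P) => [x|] [y|] //=.
  - by rewrite !mulr1 => /eqP; rewrite subr_eq0 => /eqP->.
  - by rewrite mulr0 mulr1 sub0r => /eqP; rewrite oppr_eq0 oner_eq0.
  - by rewrite mulr0 mulr1 subr0 => /eqP; rewrite oner_eq0.
split=> //; pose psi := conj_rfun phi a b c e.
have sigma0 : moebius a b c e (Some 0) = P by rewrite /moebius /= !mulr0 !add0r !mulr1 proj_ptK.
have sigma_infty : moebius a b c e None = Q by rewrite /moebius /= !mulr0 !addr0 !mulr1 proj_ptK.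
have evalE R : rf_eval psi R = moebius e (- b) (- c) a (rf_eval phi (moebius a b c e R)).
  by rewrite rf_eval_conj // moebiusK.
have critE R : is_critical psi R <-> is_critical phi (moebius a b c e R) by exact: is_critical_conj.
have psi0 : rf_eval psi (Some 0) = None by rewrite evalE sigma0 -/Q -sigma_infty moebiusK.
have psi_infty : rf_eval psi None = Some 0 by rewrite evalE sigma_infty cycle -sigma0 moebiusK.
have num0 : psi.1.[0] != 0.
  have := rf_forms_conj_neq0 rf det (_ : (0 != 0) || (1 != 0)).
  rewrite -/psi oner_eq0 orbT => /(_ isT).
  rewrite /rf_num /rf_den !homog_horner ?size_rf_num ?size_rf_den //.
  by move: psi0 => /=; case: eqP => //; rewrite orbF.
have deg_psi : rdeg psi = 2%N by rewrite rdeg_conj.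
have crit0 : is_critical psi (Some 0) by apply/critE; rewrite sigma0.
have [m [n [d [psiE n0 d0 m_eq0]]]] := critical_swap_form deg_psi num0 psi0 psi_infty crit0.
by exists m, n, d; split=> //; rewrite -sigma_infty; apply: iff_trans m_eq0 (critE None).
Qed.

Lemma critical_cycle_normal phi P : is_rfun phi -> rdeg phi = 2%N -> is_critical phi P ->
  is_periodic (rf_eval phi) 2 P -> ~ is_critical phi (rf_eval phi P) ->
  exists v a b c e, [/\ v != 0, lin_conj_by phi (phi_normal v) a b c e,
    moebius a b c e (Some 0) = P & moebius a b c e None = rf_eval phi P].
Proof.
move=> rf deg2 crit per ncrit.
have [det [m [n [d [formE n0 d0 m_eq0]]]]] := critical_cycle_form rf deg2 crit per.
set Q := rf_eval phi P in det formE ncrit m_eq0 *.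
have m0 : m != 0 by apply/eqP => /m_eq0.
pose k := - n / m; have k0 : k != 0 by rewrite mulf_neq0 ?oppr_eq0 ?invr_eq0.
have kmE : k * m = - n by rewrite divfK.
have kd0 : k ^+ 3 * d != 0 by rewrite mulf_neq0 ?expf_neq0.
exists (- n / (k ^+ 3 * d)), (ptx Q * k), (ptx P), (pty Q * k), (pty P); split.
- by rewrite mulf_neq0 ?oppr_eq0 ?invr_eq0.
- apply: conj_rfun_lin_conj (k ^+ 3 * d) _.
    have -> : ptx Q * k * pty P - ptx P * (pty Q * k) = k * (ptx Q * pty P - ptx P * pty Q) by ring.
    by rewrite mulf_neq0.
  rewrite -linear_over_square_normal // -kmE.
  rewrite -conj_linear_over_square // -formE conj_rfun_comp //.
  by rewrite !mulr0 !mulr1 !addr0 !add0r.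
- by rewrite /moebius /= !mulr0 !add0r !mulr1 proj_ptK.
- by rewrite /moebius /= !mulr0 !addr0 !mulr1 ![_ * k]mulrC proj_ptZ // proj_ptK.
Qed.

End NormalForm.

(* The conjugate n / (d x^2) of phi commutes with multiplication by a cube root of unity. *)
Lemma double_critical_cycle_aut (phi : rfun algC) P :
  is_rfun phi -> rdeg phi = 2%N -> is_critical phi P -> is_periodic (rf_eval phi) 2 P ->
  is_critical phi (rf_eval phi P) -> ~ aut_trivial phi.
Proof.
move=> rf deg2 crit per critQ.
have [det [m [n [d [formE _ d0 [_ /(_ critQ) m0]]]]]] := critical_cycle_form rf deg2 crit per.
move: (ptx _) (pty _) (ptx P) (pty P) det formE => a c b e det formE.
have [z z3] := @C_prim_root_exists 3 isT.
have zE : z ^+ 3 = 1 by apply: prim_expr_order.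
have z0 : z != 0 by rewrite (prim_root_eq0 z3).
have z1 : 1 - z != 0 by rewrite subr_eq0 eq_sym -[z]expr1 -(prim_order_dvd z3).
have commE : conj_rfun (conj_rfun phi a b c e) z 0 0 1 = scale_rfun 1 (conj_rfun phi a b c e).
  rewrite formE conj_linear_over_square // m0 mulr0 zE mul1r.
  by rewrite /scale_rfun !scale1r -surjective_pairing.
have det_z : z * 1 - 0 * 0 != 0 by rewrite mulr1 mulr0 subr0.
move=> /(_ _ _ _ _ (lin_conj_by_aut rf det det_z (oner_neq0 _) commE)) [b0 [c0 ae]].
have ab0 : a * b = 0 by apply: (mulfI z1); rewrite mulr0 -b0; ring.
have ce0 : c * e = 0 by apply: (mulfI z1); rewrite mulr0 -oppr0 -c0; ring.
have aebc0 : a * e + b * c = 0.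
  apply: (mulfI z1); rewrite mulr0; move/eqP: ae; rewrite -subr_eq0 => /eqP ae.
  by rewrite -oppr0 -ae; ring.
move/eqP: det; apply; apply/eqP; rewrite -[_ == 0](expf_eq0 _ 2).
rewrite (_ : _ ^+ 2 = (a * e + b * c) ^+ 2 - 4 * ((a * b) * (c * e))); last by ring.
by rewrite aebc0 ab0 mul0r mulr0 subr0 expf_eq0 eqxx.
Qed.

(** * Rationality of the critical point *)

Lemma is_periodic_semiconj (T T' : eqType) (f : T -> T) (g : T' -> T') (mu : T' -> T) n x :
  injective mu -> (forall y, f (mu y) = mu (g y)) ->
  is_periodic f n (mu x) <-> is_periodic g n x.
Proof.
move=> inj semi; have iterE k : iter k f (mu x) = mu (iter k g x).
  by elim: k => //= k ->.
rewrite /is_periodic iterE; split=> -[n0 [per minn]]; split=> //; split.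
- exact: inj.
- by move=> m lt_mn cycle; apply: (minn m lt_mn); rewrite iterE cycle.
- by rewrite per.
- by move=> m lt_mn; rewrite iterE => /inj; apply: minn.
Qed.

Definition map_rfun (F F' : fieldType) (f : F -> F') (phi : rfun F) : rfun F' :=
  (map_poly f phi.1, map_poly f phi.2).

Section MapRfun.
Variables (F F' : fieldType) (f : {rmorphism F -> F'}).
Implicit Types (phi : rfun F) (P : option F) (p q : {poly F}).

Lemma rdeg_map phi : rdeg (map_rfun f phi) = rdeg phi.
Proof. by rewrite /rdeg /= !size_map_poly. Qed.

Lemma is_rfun_map phi : is_rfun (map_rfun f phi) = is_rfun phi.
Proof. by rewrite /is_rfun /= coprimep_map map_poly_eq0. Qed.

Lemma rf_eval_map phi P :
  rf_eval (map_rfun f phi) (omap f P) = omap f (rf_eval phi P).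
Proof.
case: P => [a|] /=; rewrite ?rdeg_map ?horner_map ?coef_map fmorph_eq0;
  by case: ifP => _ //=; rewrite ?horner_map ?coef_map fmorph_div.
Qed.

Lemma is_periodic_map phi n P :
  is_periodic (rf_eval (map_rfun f phi)) n (omap f P) <-> is_periodic (rf_eval phi) n P.
Proof.
by apply: is_periodic_semiconj => [[x|] [y|] //= [/fmorph_inj ->] | Q]; rewrite ?rf_eval_map.
Qed.

Lemma wr_map p q : wr (map_poly f p) (map_poly f q) = map_poly f (wr p q).
Proof. by rewrite /wr rmorphB !rmorphM /= -!deriv_map. Qed.

Lemma revd_map d p : revd d (map_poly f p) = map_poly f (revd d p).
Proof.
apply/polyP => i; rewrite coef_map /= [LHS]coef_poly [(revd d p)`_i]coef_poly.
by case: ifP => _; rewrite ?coef_map ?rmorph0.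
Qed.

Lemma is_critical_map phi P :
  is_critical (map_rfun f phi) (omap f P) <-> is_critical phi P.
Proof.
have horner_eq0 p x : (map_poly f p).[f x] = 0 <-> p.[x] = 0.
  by rewrite horner_map; split=> [/eqP|->]; rewrite ?rmorph0 // fmorph_eq0 => /eqP.
have criticalE q r r' x y : f x = y ->
    (if (map_poly f q).[y] != 0 then (map_poly f r).[y] = 0 else (map_poly f r').[y] = 0)
    <-> (if q.[x] != 0 then r.[x] = 0 else r'.[x] = 0).
  by move=> <-; rewrite horner_map fmorph_eq0; case: ifP.
by case: P => [a|] /=; rewrite ?rdeg_map ?revd_map !wr_map; apply: criticalE; rewrite ?rmorph0.
Qed.

Lemma hom_comp_map d p a b c e :
  hom_comp d (map_poly f p) (f a) (f b) (f c) (f e) = map_poly f (hom_comp d p a b c e).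
Proof.
rewrite /hom_comp rmorph_sum; apply: eq_bigr => i _; rewrite -!mul_polyC.
by rewrite !(rmorphM, rmorphXn, rmorphD) /= coef_map !map_polyC map_polyX.
Qed.

Lemma lin_conj_by_map phi psi a b c e : lin_conj_by phi psi a b c e ->
  lin_conj_by (map_rfun f phi) (map_rfun f psi) (f a) (f b) (f c) (f e).
Proof.
move=> [det conjE]; split; first by rewrite -!rmorphM -rmorphB fmorph_eq0.
by rewrite /= rdeg_map !hom_comp_map -!map_polyZ -!rmorphB -!rmorphM conjE.
Qed.

Lemma map_phi_normal v : map_rfun f (phi_normal v) = phi_normal (f v).
Proof. by rewrite /map_rfun /= map_polyXn map_polyZ rmorphB /= map_polyX rmorph1. Qed.

End MapRfun.

Lemma pchar_fieldExt_rat (L : fieldExtType rat) : [pchar L] =i pred0.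
Proof. by move=> p; rewrite pchar_lalg pchar_num. Qed.

Lemma separable_rat (L : fieldExtType rat) (K E : {subfield L}) : separable K E.
Proof. by apply/separableP => x _; apply/pcharf0_separable/pchar_fieldExt_rat. Qed.

Lemma splitting_field_of_algC (x : algC) :
  exists (L : splittingFieldType rat) (LC : {rmorphism L -> algC}) (y : L), LC y = x.
Proof.
have [p [Dp mon_p] _] := minCpolyP x.
have [rs Drs] := closed_field_poly_normal (minCpoly x).
rewrite (monicP (minCpoly_monic x)) scale1r in Drs.
have [Qs [QsC [s Ds gen]]] := num_field_exists rs.
have split_p : map_poly (in_alg Qs) p = \prod_(z <- s) ('X - z%:P).
  apply: (map_poly_inj QsC); rewrite rmorph_prod /= -map_poly_comp.
  transitivity (minCpoly x).
    by rewrite Dp; apply: eq_map_poly => a /=; rewrite alg_num_field fmorph_rat.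
  by rewrite Drs -Ds big_map; apply: eq_bigr => z _; rewrite rmorphB /= map_polyX map_polyC.
have ax : SplittingField.axiom Qs.
  exists (map_poly (in_alg Qs) p); last by exists s; rewrite ?split_p ?eqpxx.
  by apply/polyOverP => i; rewrite coef_map memvZ // mem1v.
have: x \in rs by rewrite -root_prod_XsubC -Drs root_minCpoly.
rewrite -Ds => /mapP[y _ ->].
pose L : splittingFieldType rat := HB.pack Qs (FieldExt_isSplittingField.Build rat Qs ax).
by exists L, QsC, y.
Qed.

Lemma aut_fixed_rat (x : algC) :
  (forall nu : {rmorphism algC -> algC}, nu x = x) -> exists r : rat, x = ratr r.
Proof.
move=> fix_x; have [L [LC [y yE]]] := splitting_field_of_algC x.
have gal_L : galois 1 {:L} by apply/and3P; rewrite sub1v separable_rat normalFieldf.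
have: y \in fixedField ('Gal({:L} / 1%AS))%g.
  apply/fixedFieldP => [|s _]; first exact: memvf.
  have [nu nuE] := extend_algC_subfield_aut LC (s : {rmorphism L -> L}).
  by apply: (fmorph_inj LC); rewrite /= nuE yE.
move/galois_fixedField: gal_L => -> /vlineP[r yr].
by exists r; rewrite -yE yr alg_num_field fmorph_rat.
Qed.

Section Existence.
Variable phi : rfun rat.
Hypotheses (rf : is_rfun phi) (deg2 : rdeg phi = 2%N) (triv : aut_trivial (ratC phi)).

Let rC : {rmorphism rat -> algC} := ratr.
Let rfC : is_rfun (ratC phi). Proof. by rewrite (is_rfun_map rC). Qed.
Let deg2C : rdeg (ratC phi) = 2%N. Proof. by rewrite (rdeg_map rC). Qed.

Lemma critical_period2_rat P : is_critical (ratC phi) P ->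
  is_periodic (rf_eval (ratC phi)) 2 P -> exists P0, P = omap rC P0.
Proof.
move=> crit per; have ncrit : ~ is_critical (ratC phi) (rf_eval (ratC phi) P).
  by move=> critQ; apply: double_critical_cycle_aut crit per critQ triv.
have [v [a [b [c [e [v0 lc sigma0 sigma_infty]]]]]] :=
  critical_cycle_normal rfC deg2C crit per ncrit.
have det := proj1 lc; have semi R : rf_eval (ratC phi) (moebius a b c e R) =
    moebius a b c e (rf_eval (phi_normal v) R).
  by rewrite (rf_eval_lin_conj _ _ _ _ lc) ?is_rfun_normal ?rdeg_normal.
have fix_aut (nu : {rmorphism algC -> algC}) : omap nu P = P.
  have nuE : map_rfun nu (ratC phi) = ratC phi.
    by congr (_, _); rewrite -map_poly_comp; apply: eq_map_poly => x /=; rewrite fmorph_rat.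
  have := (is_periodic_map nu _ _ _).2 per; have := (is_critical_map nu _ _).2 crit.
  rewrite nuE -(moebiusVK det (omap nu P)) => crit_nu.
  rewrite (is_periodic_semiconj _ _ (can_inj (moebiusK det)) semi) => /(period2_normal v0)[] nuP.
    by rewrite nuP sigma0.
  by move: crit_nu; rewrite nuP sigma_infty.
case: P fix_aut {crit per ncrit sigma0 sigma_infty} => [x|] fix_aut; last by exists None.
have [nu|r ->] := @aut_fixed_rat x; last by exists (Some r).
by case: (fix_aut nu).
Qed.

Lemma Qconj_phi_v_exists :
  (exists P : option algC,
      is_critical (ratC phi) P /\ is_periodic (rf_eval (ratC phi)) 2 P) ->
  exists2 v : rat, v != 0 & Qconj phi (phi_v v).
Proof.
move=> [P [critC perC]]; have [P0 PE] := critical_period2_rat critC perC.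
have [crit per] : is_critical phi P0 /\ is_periodic (rf_eval phi) 2 P0.
  by rewrite PE in critC perC; split;
    [apply/(is_critical_map rC) | apply/(is_periodic_map rC)].
have ncrit : ~ is_critical phi (rf_eval phi P0).
  move=> /(is_critical_map rC); rewrite -rf_eval_map => critQ.
  by rewrite PE in critC perC; apply: double_critical_cycle_aut critC perC critQ triv.
have [v [a [b [c [e [v0 lc _ _]]]]]] := critical_cycle_normal rf deg2 crit per ncrit.
by exists v => //; exists a, b, c, e.
Qed.

End Existence.

(** * Eisenstein numbers *)

(* The pair (a, b) stands for a + b w, where w ^ 2 + w + 1 = 0. *)
Definition eis (R : Type) : Type := (R * R)%type.
HB.instance Definition _ (R : zmodType) := GRing.Zmodule.copy (eis R) (R * R)%type.

Definition Eis (R : Type) (a b : R) : eis R := (a, b).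
Definition eis_mul (R : comNzRingType) (x y : eis R) : eis R :=
  Eis (x.1 * y.1 - x.2 * y.2) (x.1 * y.2 + x.2 * y.1 - x.2 * y.2).

Lemma eisP (R : Type) (x y : eis R) : x.1 = y.1 -> x.2 = y.2 -> x = y.
Proof. by case: x y => a b [c d] /= -> ->. Qed.

Section EisensteinRing.
Variable R : comNzRingType.
Implicit Types (x y : eis R) (a : R).

Fact eis_mulA : associative (@eis_mul R).
Proof. by move=> x y z; apply: eisP => /=; ring. Qed.
Fact eis_mulC : commutative (@eis_mul R).
Proof. by move=> x y; apply: eisP => /=; ring. Qed.
Fact eis_mul1 : left_id (Eis 1 0) (@eis_mul R).
Proof. by move=> x; apply: eisP => /=; ring. Qed.
Fact eis_mulDl : left_distributive (@eis_mul R) +%R.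
Proof. by move=> x y z; apply: eisP; rewrite /=; ring. Qed.
Fact eis_one_neq0 : Eis 1 0 != 0 :> eis R.
Proof. by rewrite xpair_eqE oner_eq0. Qed.
HB.instance Definition _ := GRing.Zmodule_isComNzRing.Build (eis R)
  eis_mulA eis_mulC eis_mul1 eis_mulDl eis_one_neq0.

Lemma eis_fstD x y : (x + y).1 = x.1 + y.1. Proof. by []. Qed.
Lemma eis_sndD x y : (x + y).2 = x.2 + y.2. Proof. by []. Qed.
Lemma eis_fstN x : (- x).1 = - x.1. Proof. by []. Qed.
Lemma eis_sndN x : (- x).2 = - x.2. Proof. by []. Qed.
Lemma eis_fstM x y : (x * y).1 = x.1 * y.1 - x.2 * y.2. Proof. by []. Qed.
Lemma eis_sndM x y : (x * y).2 = x.1 * y.2 + x.2 * y.1 - x.2 * y.2. Proof. by []. Qed.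
Definition eisE := (eis_fstD, eis_sndD, eis_fstN, eis_sndN, eis_fstM, eis_sndM).

Lemma eis_cube x : x ^+ 3 =
  Eis (x.1 ^+ 3 + x.2 ^+ 3 - 3 * x.1 * x.2 ^+ 2) (3 * (x.1 * x.2 * (x.1 - x.2))).
Proof. by apply: eisP; rewrite !exprS expr0 mulr1 !eisE /=; ring. Qed.

Definition eis_norm x : R := x.1 ^+ 2 - x.1 * x.2 + x.2 ^+ 2.

Lemma eis_normM x y : eis_norm (x * y) = eis_norm x * eis_norm y.
Proof. by rewrite /eis_norm !eisE; ring. Qed.

Lemma eis_norm_const a : eis_norm (Eis a 0) = a ^+ 2.
Proof. by rewrite /eis_norm /=; ring. Qed.

Lemma eis_normX x n : eis_norm (x ^+ n) = eis_norm x ^+ n.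
Proof.
elim: n => [|n IH]; last by rewrite !exprS eis_normM IH.
by rewrite !expr0 (eis_norm_const 1) expr1n.
Qed.

Definition eis_conj x : eis R := Eis (x.1 - x.2) (- x.2).

Fact eis_conj_is_zmod_morphism : zmod_morphism eis_conj.
Proof. by move=> x y; apply: eisP; rewrite !eisE /=; ring. Qed.
Fact eis_conj_is_monoid_morphism : monoid_morphism eis_conj.
Proof. by split=> [|x y]; apply: eisP; rewrite ?eisE /=; ring. Qed.
HB.instance Definition _ := GRing.isZmodMorphism.Build (eis R) (eis R) eis_conj
  eis_conj_is_zmod_morphism.
HB.instance Definition _ := GRing.isMonoidMorphism.Build (eis R) (eis R) eis_conj
  eis_conj_is_monoid_morphism.

Lemma eis_conjK : involutive eis_conj.
Proof. by move=> x; apply: eisP => /=; ring. Qed.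

Lemma eis_mul_conj x : x * eis_conj x = Eis (eis_norm x) 0.
Proof. by apply: eisP; rewrite !eisE /eis_norm /=; ring. Qed.

Lemma eis_norm_conj x : eis_norm (eis_conj x) = eis_norm x.
Proof. by rewrite /eis_norm /=; ring. Qed.

End EisensteinRing.

Section OrderedEisenstein.
Variable R : realDomainType.
Implicit Types x y : eis R.

Lemma eis_norm_ge0 x : 0 <= eis_norm x.
Proof. by rewrite /eis_norm; nra. Qed.

Lemma eis_norm_eq0 x : (eis_norm x == 0) = (x == 0).
Proof.
apply/eqP/eqP => [norm0|->]; last by rewrite (eis_norm_const 0) expr0n.
have snd0 : x.2 = 0.
  apply/eqP; rewrite -sqrf_eq0 eq_le sqr_ge0 andbT; move: norm0; rewrite /eis_norm.
  by have := sqr_ge0 (2 * x.1 - x.2); nra.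
apply: eisP => //; move: norm0; rewrite /eis_norm snd0 mulr0 subr0 expr0n addr0.
by move/eqP; rewrite sqrf_eq0 => /eqP.
Qed.

Lemma eis_mul_eq0 x y : (x * y == 0) = (x == 0) || (y == 0).
Proof. by rewrite -!eis_norm_eq0 eis_normM mulf_eq0. Qed.

Lemma eis_lreg x : x != 0 -> GRing.lreg x.
Proof.
move=> x0 y z /eqP; rewrite -subr_eq0 -mulrBr eis_mul_eq0 (negPf x0) subr_eq0.
by move/eqP.
Qed.

End OrderedEisenstein.

Lemma cube_inj (R : realDomainType) : injective (fun x : R => x ^+ 3).
Proof.
move=> x y /= cubeE; apply/eqP; rewrite -subr_eq0.
have: (x - y) * eis_norm (Eis x (- y)) = 0.
  by rewrite /eis_norm /=; transitivity (x ^+ 3 - y ^+ 3); [ring | rewrite cubeE subrr].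
move/eqP; rewrite mulf_eq0 eis_norm_eq0 => /orP[//|/eqP[x0 y0]].
by rewrite x0 sub0r y0.
Qed.

(** * Fermat's last theorem for exponent 3 *)

Definition bezout_ring (R : comNzRingType) : Prop := forall x y : R,
  exists d u v p q, [/\ d = u * x + v * y, x = p * d & y = q * d].

Section BezoutRing.
Variable R : comNzRingType.
Implicit Types (x y z a b : R) (n : nat).

Lemma exprD_mod x y n : exists z, (x + y) ^+ n = x ^+ n + y * z.
Proof.
elim: n => [|n [z zE]]; first by exists 0; rewrite !expr0 mulr0 addr0.
by exists (x ^+ n + (x + y) * z); rewrite !exprS zE; ring.
Qed.

(* If d generates the ideal (x, z), then d ^ n.+1 generates the ideal (x). *)
Lemma coprime_mul_expS x y z a b n : bezout_ring R -> GRing.lreg x ->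
  a * x + b * y = 1 -> x * y = z ^+ n.+1 ->
  exists e e' d, e * e' = 1 /\ x = e * d ^+ n.+1.
Proof.
move=> bezout reg_x cop xy; have [d [u [v [p [q [dE xE zE]]]]]] := bezout x z.
have [k dnE] : exists k, d ^+ n.+1 = x * k.
  have [r rE] := exprD_mod (v * z) (u * x) n.+1.
  by exists (v ^+ n.+1 * y + u * r); rewrite dE addrC rE exprMn -xy; ring.
have [l xE'] : exists l, x = l * d ^+ n.+1.
  have [r rE] := exprD_mod (a * x) (b * y) n.
  exists (a ^+ n * p ^+ n.+1 + b * r * q ^+ n.+1).
  transitivity (a ^+ n * (p * d) ^+ n.+1 + b * r * (q * d) ^+ n.+1); last by rewrite !exprMn; ring.
  rewrite -xE -zE -xy; transitivity (x * (a * x + b * y) ^+ n); first by rewrite cop expr1n mulr1.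
  by rewrite rE exprMn exprS; ring.
exists l, k, d; split=> //; apply: reg_x; rewrite mulr1 [RHS]xE' dnE; ring.
Qed.

End BezoutRing.

Lemma int_bezout : bezout_ring int.
Proof.
move=> x y; have [u [v uv]] := Bezoutz x y.
have /dvdzP[p pE] := dvdz_gcdl x y; have /dvdzP[q qE] := dvdz_gcdr x y.
by exists (gcdz x y), u, v, p, q.
Qed.

Lemma round_div (s n : int) : 0 < n -> exists q, - n <= 2 * (s - q * n) <= n.
Proof.
move=> n0; exists ((2 * s + n) %/ (2 * n))%Z.
have := divz_eq (2 * s + n) (2 * n).
have := modz_ge0 (2 * s + n) (d := 2 * n); have := ltz_pmod (2 * s + n) (d := 2 * n).
move: (_ %/ _)%Z (_ %% _)%Z => q r; nia.
Qed.

Lemma eis_euclid (x y : eis int) : y != 0 -> exists q, eis_norm (x - q * y) < eis_norm y.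
Proof.
move=> y0; set n := eis_norm y.
have n0 : 0 < n by rewrite lt0r eis_norm_eq0 y0 eis_norm_ge0.
pose z := x * eis_conj y.
have [q1 round1] := round_div z.1 n0; have [q2 round2] := round_div z.2 n0.
exists (Eis q1 q2); rewrite -(ltr_pM2r n0) {1}/n -(eis_norm_conj y) -eis_normM.
have -> : (x - Eis q1 q2 * y) * eis_conj y = Eis (z.1 - q1 * n) (z.2 - q2 * n).
  by rewrite mulrBl -mulrA eis_mul_conj -/n -/z; apply: eisP; rewrite !eisE /=; ring.
move: round1 round2; rewrite /eis_norm /=.
move: (z.1 - _) (z.2 - _) => s t; clear -n0; move=> *; nia.
Qed.

Lemma eis_int_bezout : bezout_ring (eis int).
Proof.
move=> x y; have [N] := ubnP `|eis_norm y|%N; elim: N x y => // N IH x y lt_yN.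
have [->|y0] := eqVneq y 0; first by exists x, 1, 0, 1, 0; split; ring.
have [k lt_k] := eis_euclid x y0.
have [|d [u [v [p [q [dE yE xE]]]]]] := IH y (x - k * y).
  rewrite -ltz_nat gez0_abs ?eis_norm_ge0 // (lt_le_trans lt_k) //.
  by rewrite -[eis_norm y]gez0_abs ?eis_norm_ge0 // lez_nat -ltnS.
exists d, v, (u - v * k), (q + k * p), p; split=> //; first by rewrite dE; ring.
by rewrite -[LHS](subrK (k * y)) xE yE; ring.
Qed.

Lemma coprimez_mul_cube (a b c : int) :
  coprimez a b -> a * b = c ^+ 3 -> exists r, a = r ^+ 3.
Proof.
have [->|a0] := eqVneq a 0; first by exists 0.
move=> /coprimezP[[u v] /= uv] /(coprime_mul_expS int_bezout (mulfI a0) uv)[e [e' [d [ee' ->]]]].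
have [->|->] : e = 1 \/ e = -1.
  by have /eqP := congr1 absz ee'; rewrite abszM muln_eq1 => /andP[/eqP abs_e _]; lia.
- by exists d; rewrite mul1r.
- by exists (- d); ring.
Qed.

Lemma coprimez3 (x : int) : coprimez 3 x = ~~ (3 %| x)%Z.
Proof. by rewrite coprimezE prime_coprime. Qed.

Lemma Euclid3z (x y : int) : (3 %| x * y)%Z = (3 %| x)%Z || (3 %| y)%Z.
Proof. by rewrite !dvdzE abszM Euclid_dvdM. Qed.

(* A unit whose w-coordinate is divisible by 3 is 1 or -1. *)
Lemma eis_cube_of_associate (x e e' y : eis int) : e * e' = 1 -> x = e * y ^+ 3 ->
  (3 %| x.2)%Z -> ~~ (3 %| eis_norm x)%Z -> exists z, x = z ^+ 3.
Proof.
move=> ee' xE /dvdzP[i x2] norm_x.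
have norm_e : eis_norm e = 1.
  have /(congr1 absz)/eqP : eis_norm e * eis_norm e' = 1 by rewrite -eis_normM ee'.
  rewrite abszM muln_eq1 => /andP[/eqP abs_e _].
  by rewrite -(gez0_abs (eis_norm_ge0 e)) abs_e.
pose r := (y ^+ 3).1; pose s := y.1 * y.2 * (y.1 - y.2).
have cubeE : y ^+ 3 = Eis r (3 * s) by rewrite /r eis_cube.
have /dvdzP[k e2] : (3 %| e.2)%Z.
  have: (3 %| e.2 * r)%Z.
    apply/dvdzP; exists (i - e.1 * s + e.2 * s); move: x2; rewrite xE cubeE eis_sndM /=.
    move=> x2; transitivity (i * 3 - 3 * (e.1 * s - e.2 * s)); last by ring.
    by rewrite -x2; ring.
  rewrite Euclid3z => /orP[//|/dvdzP[j rE]]; case/negP: norm_x; apply/dvdzP.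
  exists (3 * j ^+ 2 - 3 * j * s + 3 * s ^+ 2).
  by rewrite xE eis_normM norm_e cubeE rE /eis_norm /=; ring.
have e2_0 : e.2 = 0 by move: norm_e; rewrite /eis_norm e2; move: (e.1); clear; nia.
have [e1|e1] : e.1 = 1 \/ e.1 = -1.
- by move: norm_e; rewrite /eis_norm e2_0; move: (e.1); clear; nia.
- exists y; rewrite xE; apply: eisP; rewrite !eisE e1 e2_0; ring.
- exists (- y); rewrite xE exprNn; apply: eisP; rewrite !eisE e1 e2_0 /=; ring.
Qed.

Lemma cube_mod3 (x : int) : exists i, x ^+ 3 = x + 3 * i.
Proof.
have [i [xE|[xE|xE]]] : exists i, x = 3 * i \/ x = 3 * i + 1 \/ x = 3 * i - 1.
- exists ((x + 1) %/ 3)%Z; lia.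
- by exists (9 * i ^+ 3 - i); rewrite xE; ring.
- by exists (9 * i ^+ 3 + 9 * i ^+ 2 + 2 * i); rewrite xE; ring.
- by exists (9 * i ^+ 3 - 9 * i ^+ 2 + 2 * i); rewrite xE; ring.
Qed.

Lemma cube_mod9 (x : int) : ~~ (3 %| x)%Z ->
  exists k, x ^+ 3 = 9 * k + 1 \/ x ^+ 3 = 9 * k - 1.
Proof.
move=> nx; have [i [xE|xE]] : exists i, x = 3 * i + 1 \/ x = 3 * i - 1.
- exists ((x + 1) %/ 3)%Z; lia.
- by exists (3 * i ^+ 3 + 3 * i ^+ 2 + i); left; rewrite xE; ring.
- by exists (3 * i ^+ 3 - 3 * i ^+ 2 + i); right; rewrite xE; ring.
Qed.

Lemma eis_cube_of_norm_cube (x : eis int) (s t m : int) :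
  s * (3 * x.2) + t * eis_norm x = 1 -> eis_norm x = m ^+ 3 -> (3 %| x.2)%Z ->
  exists y, x = y ^+ 3.
Proof.
move=> st normE dvd_x2.
have ndvd : ~~ (3 %| eis_norm x)%Z.
  rewrite -coprimez3; apply/coprimezP; exists (s * x.2, t) => /=; rewrite -[RHS]st; ring.
have x0 : x != 0.
  by apply: contraNneq ndvd => ->; rewrite (eis_norm_const 0) expr0n dvdz0.
have prd : x * eis_conj x = (Eis m 0) ^+ 3.
  by rewrite eis_mul_conj normE eis_cube; apply: eisP => /=; ring.
(* (1 + 2 w) (x - conj x) = (1 + 2 w) ^ 2 x.2 = - 3 x.2 *)
have cop : (Eis t 0 * eis_conj x - Eis s 0 * Eis 1 2) * x + (Eis s 0 * Eis 1 2) * eis_conj x = 1.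
  apply: eisP; last by rewrite !eisE /=; ring.
  by rewrite -[RHS]st !eisE /eis_norm /=; ring.
have [e [e' [y [ee' xE]]]] := coprime_mul_expS eis_int_bezout (eis_lreg x0) cop prd.
exact: eis_cube_of_associate ee' xE dvd_x2 ndvd.
Qed.

Lemma coprimez_cubes (x y z : int) : coprimez x y -> x * y * (x - y) = z ^+ 3 ->
  exists r s t,
  [/\ x = r ^+ 3, y = s ^+ 3, x - y = t ^+ 3 & z = r * s * t] /\ coprimez s t.
Proof.
move=> cop prod.
have cop_y : coprimez y (x - y).
  rewrite /coprimez (_ : x - y = (-1) * y + x); last by ring.
  by rewrite gcdzMDl -/(coprimez _ _) coprimez_sym.
have cop_x : coprimez x (x - y).
  by rewrite /coprimez (_ : x - y = 1 * x + - y) ?gcdzMDl ?gcdzN //; ring.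
have [r rE] : exists r, x = r ^+ 3.
  by apply: (@coprimez_mul_cube _ (y * (x - y)) z); rewrite ?coprimezMr ?cop ?mulrA.
have [s sE] : exists s, y = s ^+ 3.
  apply: (@coprimez_mul_cube _ (x * (x - y)) z); last by rewrite -prod; ring.
  by rewrite coprimezMr coprimez_sym cop.
have [t tE] : exists t, x - y = t ^+ 3.
  apply: (@coprimez_mul_cube _ (x * y) z); last by rewrite -prod; ring.
  by rewrite coprimezMr ![coprimez (x - y) _]coprimez_sym cop_x.
exists r, s, t; split; last by move: cop_y; rewrite tE sE coprimez_pexpl // coprimez_pexpr.
split=> //; apply: cube_inj => /=.
by rewrite -prod tE [in LHS]rE [in LHS]sE; ring.
Qed.

Lemma coprimez_sum3 (x y : int) : coprimez x y -> (3 %| x + y)%Z -> ~~ (3 %| x * y)%Z.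
Proof.
move=> cop dvd_sum; rewrite Euclid3z; apply/negP => dvd_xy.
have: (3 %| gcdz x y)%Z.
  rewrite dvdz_gcd; case/orP: dvd_xy => dvd; first by rewrite dvd -(rpredDl _ dvd).
  by rewrite dvd -(rpredDr _ dvd) dvd_sum.
by rewrite (eqP cop).
Qed.

Lemma fermat3_factor (x y z : int) : coprimez x y -> (3 %| z)%Z -> x ^+ 3 + y ^+ 3 = z ^+ 3 ->
  exists n m, [/\ x + y = 9 * n ^+ 3, x ^+ 2 - x * y + y ^+ 2 = 3 * m ^+ 3, z = 3 * (n * m)
    & coprimez (9 * n ^+ 3) (m ^+ 3)].
Proof.
move=> cop /dvdzP[z' zE] fermat.
have [k kE] : exists k, x + y = 3 * k.
  have [i iE] := cube_mod3 x; have [j jE] := cube_mod3 y.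
  exists (9 * z' ^+ 3 - i - j); move: fermat; rewrite iE jE zE => fermat.
  by transitivity (x + 3 * i + (y + 3 * j) - 3 * (i + j)); [|rewrite fermat]; ring.
have yE : y = 3 * k - x by rewrite -kE; ring.
have ndvd_xy : ~~ (3 %| x * y)%Z by rewrite coprimez_sum3 // kE dvdz_mulr.
have z3E : 3 * z' ^+ 3 = k * (k ^+ 2 * 3 - x * y).
  apply: (@mulfI _ (9 : int)) => //; transitivity (z ^+ 3); first by rewrite zE; ring.
  by rewrite -fermat yE; ring.
have /dvdzP[l lE] : (3 %| k)%Z.
  have := dvdz_mulr (z' ^+ 3) (dvdzz 3); rewrite z3E Euclid3z => /orP[//|].
  by rewrite (rpredBl _ (dvdz_mull _ (dvdzz 3))) (negPf ndvd_xy).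
have z'3E : z' ^+ 3 = l * (27 * l ^+ 2 - x * y).
  by apply: (@mulfI _ (3 : int)) => //; rewrite z3E lE; ring.
have {}yE : y = 9 * l - x by rewrite yE lE; ring.
have cop_l : coprimez l (27 * l ^+ 2 - x * y).
  have cop_lx : coprimez l x.
    have [[u v] /= uv] := coprimezP _ _ cop; apply/coprimezP; exists (9 * v, u - v) => /=.
    by rewrite -[RHS]uv yE; ring.
  rewrite (_ : 27 * l ^+ 2 - x * y = (27 * l - 9 * x) * l + x ^+ 2); last by rewrite yE; ring.
  by rewrite /coprimez gcdzMDl -/(coprimez _ _) coprimezXr.
have [n nE] := coprimez_mul_cube cop_l (esym z'3E).
have [m mE] : exists m, 27 * l ^+ 2 - x * y = m ^+ 3.
  by apply: (@coprimez_mul_cube _ l z'); rewrite 1?coprimez_sym // mulrC.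
exists n, m; split; rewrite -?nE -?mE.
- by rewrite kE lE; ring.
- by rewrite yE; ring.
- rewrite zE mulrC; congr (_ * _); apply: cube_inj; rewrite /= z'3E mE nE; ring.
rewrite coprimezMl cop_l andbT (_ : 9 = 3 ^+ 2) // coprimezXl // coprimez3.
by rewrite (rpredBl _ (dvdz_mulr _ _)).
Qed.

Lemma fermat3_eis (x y n m : int) : x + y = 9 * n ^+ 3 ->
  x ^+ 2 - x * y + y ^+ 2 = 3 * m ^+ 3 -> coprimez (9 * n ^+ 3) (m ^+ 3) ->
  exists c d, coprimez c d /\ c * d * (c - d) = n ^+ 3.
Proof.
move=> sumE prodE /coprimezP[[s t] /= st].
(* (x + y w) / (1 - w) *)
pose th := Eis (x - 3 * n ^+ 3) (3 * n ^+ 3).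
have normE : eis_norm th = m ^+ 3.
  apply: (@mulfI _ (3 : int)) => //; rewrite -prodE (_ : y = 9 * n ^+ 3 - x).
    by rewrite /eis_norm /=; ring.
  by rewrite -sumE; ring.
have [||[c d] thE] := eis_cube_of_norm_cube (s := s) (t := t) _ normE.
- by rewrite normE /= -[RHS]st; ring.
- by rewrite dvdz_mulr.
have nE : c * d * (c - d) = n ^+ 3.
  apply: (@mulfI _ (3 : int)) => //; have := congr1 snd thE; rewrite eis_cube /= => ->.
  by ring.
exists c, d; split=> //; pose q := eis_norm (Eis c d).
have mE : m ^+ 3 = q ^+ 3 by rewrite -normE thE eis_normX.
apply/coprimezP; exists (9 * s * (d * (c - d)) + t * (c - d) * q ^+ 2, t * d * q ^+ 2) => /=.
by rewrite -[RHS]st mE -nE /q /eis_norm /=; ring.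
Qed.

Lemma fermat3_descent (x y z : int) : coprimez x y -> (3 %| z)%Z -> z != 0 ->
  x ^+ 3 + y ^+ 3 = z ^+ 3 -> exists r s t : int,
  [/\ coprimez s t, s ^+ 3 + t ^+ 3 = r ^+ 3, r * s * t != 0 & (`|(r * s * t)%R| < `|z|)%N].
Proof.
move=> cop dvd_z z0 /(fermat3_factor cop dvd_z)[n [m [sumE prodE zE cop_nm]]].
have [c [d [cop_cd /(coprimez_cubes cop_cd)[r [s [t [[rE sE tE nE] cop_st]]]]]]] :=
  fermat3_eis sumE prodE cop_nm.
have [n0 m0] : n != 0 /\ m != 0.
  by split; apply: contra_neq z0; rewrite zE => ->; rewrite ?mul0r !mulr0.
exists r, s, t; rewrite -nE; split=> //; first by rewrite -sE -tE -rE; ring.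
rewrite zE !abszM; move: n0 m0; rewrite -!absz_eq0 -!lt0n.
by move: `|n|%N `|m|%N; clear; nia.
Qed.

Lemma fermat3_coprime (x y z : int) : coprimez x y -> x ^+ 3 + y ^+ 3 = z ^+ 3 ->
  x * y * z = 0.
Proof.
have [N] := ubnP `|(x * y * z)%R|%N; elim: N x y z => // N IH x y z lt_N cop fermat.
apply/eqP; apply: contraT => xyz0.
(* One of the three is divisible by 3; after a permutation it is the one on the right. *)
have dvd3_absurd a b c : coprimez a b -> (3 %| c)%Z -> a ^+ 3 + b ^+ 3 = c ^+ 3 ->
    `|(a * b * c)%R|%N = `|(x * y * z)%R|%N -> False.
  move=> cop_ab dvd_c fermat_abc abcE.
  have abc0 : a * b * c != 0 by rewrite -absz_eq0 abcE absz_eq0.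
  have c0 : c != 0 by apply: contra_neq abc0 => ->; rewrite mulr0.
  have [r [s [t [cop_st fermat_st rst0 lt_rst]]]] := fermat3_descent cop_ab dvd_c c0 fermat_abc.
  suff str0 : s * t * r = 0 by case/eqP: rst0; rewrite -[RHS]str0; ring.
  apply: IH => //; rewrite (_ : s * t * r = r * s * t); last by ring.
  apply: leq_trans lt_rst _; move: lt_N; rewrite -abcE abszM ltnS; apply: leq_trans.
  by apply: leq_pmull; rewrite lt0n absz_eq0; apply: contra_neq abc0 => ->; rewrite mul0r.
have cop_z a b : coprimez a b -> a ^+ 3 + b ^+ 3 = z ^+ 3 -> coprimez z (- b).
  move=> cop_ab fermat_ab; rewrite -(coprimez_pexpl (k := 3)) // -fermat_ab coprimezN.
  rewrite coprimez_sym /coprimez (_ : a ^+ 3 + b ^+ 3 = b ^+ 2 * b + a ^+ 3); last by ring.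
  by rewrite gcdzMDl -/(coprimez _ _) coprimez_pexpr // coprimez_sym.
have [dvd_z | /cube_mod9[k z3E]] := boolP (3 %| z)%Z; first by case: (dvd3_absurd x y z).
have [dvd_x | /cube_mod9[i x3E]] := boolP (3 %| x)%Z.
  case: (dvd3_absurd z (- y) x); rewrite ?(cop_z x) //; first by rewrite exprNn -fermat; ring.
  by rewrite -abszN; congr absz; ring.
have [dvd_y | /cube_mod9[j y3E]] := boolP (3 %| y)%Z.
  case: (dvd3_absurd z (- x) y); rewrite ?(cop_z y) 1?coprimez_sym 1?[y ^+ 3 + _]addrC //.
    by rewrite exprNn -fermat; ring.
  by rewrite -abszN; congr absz; ring.
by move: fermat x3E y3E z3E; move: (x ^+ 3) (y ^+ 3) (z ^+ 3); clear; lia.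
Qed.

Lemma fermat3_int (x y z : int) : x ^+ 3 + y ^+ 3 = z ^+ 3 -> x * y * z = 0.
Proof.
move=> fermat; have [->|x0] := eqVneq x 0; first by rewrite !mul0r.
have g0 : gcdz x y != 0 by rewrite gcdz_eq0 (negPf x0).
have /dvdzP[a aE] := dvdz_gcdl x y; have /dvdzP[b bE] := dvdz_gcdr x y.
set g := gcdz x y in g0 aE bE.
have /dvdzP[c cE] : (g %| z)%Z.
  by rewrite -(@dvdz_pexp2r _ _ 3) // -fermat aE bE !exprMn -mulrDl dvdz_mull.
have cop_ab : coprimez a b.
  have [u [v uv]] := Bezoutz x y; apply/coprimezP; exists (u, v) => /=.
  by apply: (mulIf g0); rewrite mul1r -[RHS]uv [in RHS]aE [in RHS]bE; ring.
have abc0 : a * b * c = 0.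
  apply: fermat3_coprime => //; apply: (mulIf (expf_neq0 3 g0)).
  by rewrite mulrDl -!exprMn -aE -bE -cE.
by rewrite aE bE cE; transitivity (a * b * c * g ^+ 3); [ring | rewrite abc0 mul0r].
Qed.

Lemma fermat3_rat (x y z : rat) : x ^+ 3 + y ^+ 3 = z ^+ 3 -> x * y * z = 0.
Proof.
move=> fermat; pose d := denq x * denq y * denq z.
have d0 : d%:~R != 0 :> rat by rewrite intr_eq0 !mulf_neq0 ?denq_neq0.
have int_multiple (r : rat) : (denq r %| d)%Z -> exists n : int, r * d%:~R = n%:~R.
  move=> /dvdzP[k ->]; exists (numq r * k); rewrite !intrM -{1}(divq_num_den r).
  by field; rewrite intr_eq0 denq_neq0.
have [|a aE] := int_multiple x; first by rewrite /d -mulrA dvdz_mulr.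
have [|b bE] := int_multiple y; first by rewrite /d mulrAC dvdz_mull.
have [|c cE] := int_multiple z; first by rewrite /d dvdz_mull.
apply: (mulIf (expf_neq0 3 d0)); rewrite mul0r.
transitivity (x * d%:~R * (y * d%:~R) * (z * d%:~R)); first by ring.
rewrite aE bE cE -!intrM; apply/eqP; rewrite intr_eq0; apply/eqP/fermat3_int/(@intr_inj rat).
by rewrite intrD !rmorphXn /= -aE -bE -cE !exprMn -mulrDl fermat.
Qed.

(** * Cubes in the field of Eisenstein numbers *)

Lemma eis_conj_fixed (R : realDomainType) (x : eis R) : (eis_conj x == x) = (x.2 == 0).
Proof.
apply/eqP/eqP => [/(congr1 snd) /= x2 | x2]; first by lra.
by apply: eisP; rewrite /= x2 ?subr0 ?oppr0.
Qed.

Lemma eis_cube_const (R : realDomainType) (x : eis R) a : x ^+ 3 = Eis a 0 ->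
  exists b, b ^+ 3 = a.
Proof.
rewrite eis_cube => -[aE /eqP]; rewrite !mulf_eq0 pnatr_eq0 /= subr_eq0.
rewrite -aE => /orP[/orP[]|] /eqP->; [exists x.2 | exists x.1 | exists (- x.2)]; ring.
Qed.

Lemma eis_Hilbert90 (R : realDomainType) (x : eis R) : eis_norm x = 1 ->
  exists2 y, y != 0 & x * y = eis_conj y.
Proof.
move=> norm_x; have [y0 | y0] := eqVneq (1 + eis_conj x) 0; last first.
  exists (1 + eis_conj x) => //.
  by rewrite rmorphD rmorph1 /= eis_conjK mulrDr mulr1 eis_mul_conj norm_x addrC.
have -> : x = -1.
  by move/(congr1 (@eis_conj _)): y0; rewrite rmorphD rmorph1 rmorph0 /= eis_conjK => /addr0_eq.
exists (Eis 1 2); first by rewrite xpair_eqE oner_eq0.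
by rewrite mulN1r; apply: eisP; rewrite !eisE /=; ring.
Qed.

(* 1 - 3 (1 - w) / v *)
Definition cycle_resolvent (v : rat) : eis rat := Eis (1 - 3 / v) (3 / v).

Section CycleResolvent.
Variable v : rat.
Hypothesis v0 : v != 0.
Local Notation alpha := (cycle_resolvent v).

Lemma cycle_resolvent_snd_neq0 : alpha.2 != 0.
Proof. by rewrite /= mulf_neq0 ?invr_eq0. Qed.

Lemma cycle_resolvent_neq0 : alpha != 0.
Proof. by apply: contraNneq cycle_resolvent_snd_neq0 => ->. Qed.

Lemma cycle_resolvent_norm : eis_norm alpha = (1 - 3 / v) ^+ 3 + (3 / v) ^+ 3.
Proof. by rewrite /eis_norm /=; ring. Qed.

Lemma cycle_resolvent_norm_not_cube (y : rat) : v != 3 -> y ^+ 3 != eis_norm alpha.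
Proof.
rewrite cycle_resolvent_norm => v3; apply: contraNneq v3 => cubeE.
have /eqP := fermat3_rat (esym cubeE); rewrite !mulf_eq0 invr_eq0 (negPf v0) !orbF /=.
case/orP=> [/eqP ratio1 | /eqP y0]; first by rewrite -[v]mul1r [X in X * _](subr0_eq ratio1) divfK.
case/negP: cycle_resolvent_neq0.
by rewrite -eis_norm_eq0 cycle_resolvent_norm -cubeE y0 expr0n.
Qed.

Lemma cycle_resolvent_snd (c : eis rat) : v * (alpha * c ^+ 3).2 =
  3 * ((v - 6) * (c.1 * c.2 * (c.1 - c.2)) + c.1 ^+ 3 + c.2 ^+ 3 - 3 * c.1 * c.2 ^+ 2).
Proof. by rewrite eis_cube eis_sndM /=; field. Qed.

Lemma in_eta_of_twist c : c != 0 -> (alpha * c ^+ 3).2 = 0 -> in_eta v.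
Proof.
move=> c0 snd0; have := cycle_resolvent_snd c; rewrite snd0 mulr0.
case: c c0 {snd0} => r s /= c0 /esym/eqP; rewrite mulf_eq0 pnatr_eq0 /= => /eqP linear_v.
have rs0 : r * s * (r - s) != 0.
  apply: contraNneq c0 => rs0; move: linear_v; rewrite rs0 mulr0 add0r => cube0.
  move/eqP: rs0; rewrite !mulf_eq0 subr_eq0 => /orP[/orP[]|] /eqP rsE.
  - have /eqP : s ^+ 3 = 0 by rewrite -cube0 rsE; ring.
    by rewrite expf_eq0 /= rsE xpair_eqE eqxx.
  - have /eqP : r ^+ 3 = 0 by rewrite -cube0 rsE; ring.
    by rewrite expf_eq0 /= rsE xpair_eqE eqxx andbT.
  - have /eqP : s ^+ 3 = 0 by rewrite -oppr0 -cube0 rsE; ring.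
    by rewrite expf_eq0 /= rsE xpair_eqE andbb.
move: (rs0); rewrite !mulf_eq0 !negb_or => /andP[/andP[r0 s0] neq_rs].
exists (1 - r / s); split; last split.
- by rewrite subr_eq0 eq_sym -subr_eq0 -(mulIr_eq0 _ (mulIf s0)) mulrBl divfK // mul1r.
- by rewrite -subr_eq0 addrAC subrr add0r oppr_eq0 mulf_neq0 ?invr_eq0.
have -> : v = 6 - (r ^+ 3 + s ^+ 3 - 3 * r * s ^+ 2) / (r * s * (r - s)).
  by apply: (mulIf rs0); rewrite mulrBl divfK // -[LHS]subr0 -linear_v; ring.
have -> : 1 - r / s = (s - r) / s by field.
have -> : (s - r) / s - 1 = - (r / s) by field.
by field; rewrite s0 r0 neq_rs andbT -opprB oppr_eq0.
Qed.

Lemma twist_of_in_eta : in_eta v -> exists2 c, c != 0 & (alpha * c ^+ 3).2 = 0.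
Proof.
move=> [u [u0 [u1 vE]]]; exists (Eis (1 - u) 1); first by rewrite xpair_eqE oner_eq0 andbF.
have u_neq0 : u * (u - 1) != 0 by rewrite mulf_neq0 // subr_eq0.
apply: (mulfI v0); rewrite mulr0 cycle_resolvent_snd /=.
have clear_denE : v * (u * (u - 1)) = u ^+ 3 + 3 * u ^+ 2 - 6 * u + 1 by rewrite vE divfK.
transitivity (3 * (v * (u * (u - 1)) - (u ^+ 3 + 3 * u ^+ 2 - 6 * u + 1))); first by ring.
by rewrite clear_denE subrr mulr0.
Qed.

Lemma in_eta_of_conj_quotient b : alpha = eis_conj alpha * b ^+ 3 -> in_eta v.
Proof.
move=> alphaE; have alpha0 : eis_norm alpha != 0 by rewrite eis_norm_eq0 cycle_resolvent_neq0.
have [|c c0 bc] := @eis_Hilbert90 _ b.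
  apply: cube_inj => /=; rewrite expr1n; apply: (mulfI alpha0).
  by rewrite mulr1 -eis_normX -{1}eis_norm_conj -eis_normM -alphaE.
apply: (in_eta_of_twist c0); apply/eqP; rewrite -eis_conj_fixed.
by rewrite rmorphM rmorphXn /= -bc exprMn mulrA -alphaE.
Qed.

End CycleResolvent.

(** * Points of period 3 *)

Definition is_omega (R : pzRingType) (w : R) : Prop := w ^+ 2 + w + 1 = 0.

Section CubeRootsOfUnity.
Variable R : comNzRingType.
Implicit Types w : R.

Lemma omega_sqr w : is_omega w -> w ^+ 2 = - w - 1.
Proof. by move=> w1; rewrite -[LHS]subr0 -w1; ring. Qed.

Lemma omega_cube w : is_omega w -> w ^+ 3 = 1.
Proof. by move/omega_sqr=> w2; ring: w2. Qed.

Lemma is_omega_sqr w : is_omega w -> is_omega (w ^+ 2).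
Proof. by move/omega_sqr=> w2; rewrite /is_omega; ring: w2. Qed.

Lemma is_omega_map (S : comNzRingType) (f : {rmorphism R -> S}) w :
  is_omega w -> is_omega (f w).
Proof. by rewrite /is_omega => w1; rewrite -rmorphXn -(rmorph1 f) -!rmorphD w1 rmorph0. Qed.

Lemma omega_neq0 w : is_omega w -> w != 0.
Proof. by apply: contra_eq_neq => ->; rewrite expr0n !add0r oner_eq0. Qed.

Lemma omega_neq1 w : 3 != 0 :> R -> is_omega w -> w != 1.
Proof. by move=> three0; apply: contra_eq_neq => ->; rewrite (_ : _ + _ = 3) //; ring. Qed.

End CubeRootsOfUnity.

Lemma omega_orbit (R : idomainType) (w a u : R) : is_omega w -> u ^+ 3 = a ^+ 3 ->
  exists i : 'I_3, u = w ^+ i * a.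
Proof.
move=> /omega_sqr w2 cubeE.
have: (u - a) * ((u - w * a) * (u - w ^+ 2 * a)) = 0.
  by transitivity (u ^+ 3 - a ^+ 3); [ring: w2 | rewrite cubeE subrr].
move/eqP; rewrite !mulf_eq0 !subr_eq0 => /or3P[] /eqP->.
- by exists (inord 0); rewrite inordK // mul1r.
- by exists (inord 1); rewrite inordK.
- by exists (inord 2); rewrite inordK.
Qed.

(* The points of period 3 are the cycle_pt w u with u ^ 3 = cycle_cube v w; in the coordinate
   u = 1 - (1 - w) / x the map phi_normal v multiplies them by w. *)
Definition cycle_cube (F : fieldType) (v w : F) : F := 1 - 3 * (1 - w) / v.
Definition cycle_pt (F : fieldType) (w u : F) : F := (1 - w) / (1 - u).

Lemma three_cycle_eq (R : comNzRingType) (r s t : R) :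
  s * (1 - s) = r * (1 - t) -> t * (1 - t) = s * (1 - r) ->
  (t - s) * ((t - 1) ^+ 2 + (t - 1) * s + s ^+ 2) = 0.
Proof.
move=> /eqP; rewrite -subr_eq0 => /eqP eq_rs /eqP; rewrite -subr_eq0 => /eqP eq_tr.
transitivity ((1 - t) * (t * (1 - t) - s * (1 - r)) + s * (s * (1 - s) - r * (1 - t))).
  by ring.
by rewrite eq_rs eq_tr !mulr0 addr0.
Qed.

Lemma rotation_cube (R : comNzRingType) (w s : R) : is_omega w ->
  (1 - (1 - w) * s) ^+ 3 = 1 - 3 * (1 - w) * (s * (1 + w * s) * (1 - s)).
Proof. by move/omega_sqr=> w2; ring: w2. Qed.

Section ThreeCycles.
Variables (F : fieldType) (v : F).
Hypotheses (three0 : 3 != 0 :> F) (v0 : v != 0).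
Implicit Types w u x s : F.

Lemma rf_eval_normal_inv s : s != 0 ->
  rf_eval (phi_normal v) (Some s^-1) = Some (v * (s * (1 - s))).
Proof.
by move=> s0; rewrite rf_eval_normal ?invr_eq0 // exprVn invrK; congr Some; field.
Qed.

Lemma one_sub_omega_neq0 w : is_omega w -> 1 - w != 0.
Proof. by move=> w1; rewrite subr_eq0 eq_sym omega_neq1. Qed.

Lemma cycle_cube_neq1 w u : is_omega w -> u ^+ 3 = cycle_cube v w -> 1 - u != 0.
Proof.
move=> w1 uE; apply: contra_eq_neq uE => /subr0_eq <-; rewrite expr1n /cycle_cube eq_sym.
by rewrite -subr_eq0 addrAC subrr add0r oppr_eq0 !mulf_neq0 ?invr_eq0 ?one_sub_omega_neq0.
Qed.

Lemma cycle_cube_rot w u : is_omega w -> u ^+ 3 = cycle_cube v w -> (w * u) ^+ 3 = cycle_cube v w.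
Proof. by move=> w1 <-; rewrite exprMn omega_cube ?mul1r. Qed.

Lemma cycle_ptK w x : 1 - w != 0 -> x != 0 -> cycle_pt w (1 - (1 - w) / x) = x.
Proof. by move=> w0 x0; rewrite /cycle_pt subKr invf_div mulrC divfK. Qed.

Lemma cycle_pt_coord w u : 1 - w != 0 -> 1 - u != 0 -> 1 - (1 - w) / cycle_pt w u = u.
Proof. by move=> w0 u0; rewrite /cycle_pt invf_div mulrC divfK ?subKr. Qed.

Lemma rf_eval_cycle_pt w u : is_omega w -> u ^+ 3 = cycle_cube v w ->
  rf_eval (phi_normal v) (Some (cycle_pt w u)) = Some (cycle_pt w (w * u)).
Proof.
move=> w1 uE; have w0 := one_sub_omega_neq0 w1.
have u0 := cycle_cube_neq1 w1 uE; have wu0 := cycle_cube_neq1 w1 (cycle_cube_rot w1 uE).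
pose s := (1 - u) / (1 - w); have s0 : s != 0 by rewrite mulf_neq0 ?invr_eq0.
have tE : 1 + w * s = (1 - w * u) / (1 - w) by rewrite /s; field.
have t0 : 1 + w * s != 0 by rewrite tE mulf_neq0 ?invr_eq0.
have cycle : v * (s * (1 + w * s) * (1 - s)) = 1.
  apply: (mulfI (mulf_neq0 three0 w0)); have := rotation_cube s w1.
  rewrite [(1 - w) * s]mulrC divfK // subKr uE => /addrI/oppr_inj cubeE.
  by rewrite mulrCA -cubeE mulr1 mulrC divfK.
rewrite (_ : cycle_pt w u = s^-1) ?rf_eval_normal_inv /s ?invf_div // -/s; congr Some.
rewrite (_ : cycle_pt _ _ = (1 + w * s)^-1); last by rewrite tE invf_div.
by apply: (mulIf t0); rewrite mulVf // -[RHS]cycle; ring.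
Qed.

Lemma cycle_pt_periodic w u : is_omega w -> u != 0 -> u ^+ 3 = cycle_cube v w ->
  is_periodic (rf_eval (phi_normal v)) 3 (Some (cycle_pt w u)).
Proof.
move=> w1 u_neq0 uE; have uwE := cycle_cube_rot w1 uE; have uw2E := cycle_cube_rot w1 uwE.
have w0 := one_sub_omega_neq0 w1; have u0 := cycle_cube_neq1 w1.
have step u' := @rf_eval_cycle_pt w u' w1.
have inj u' : u' ^+ 3 = cycle_cube v w -> cycle_pt w u' = cycle_pt w u -> u' = u.
  by move=> /u0 u'0 ptE; rewrite -(cycle_pt_coord w0 u'0) ptE (cycle_pt_coord w0 (u0 _ uE)).
have w_neq1 : w != 1 by rewrite eq_sym -subr_eq0.
have w3u : w * (w * (w * u)) = u by transitivity (w ^+ 3 * u); [ring | rewrite omega_cube ?mul1r].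
move: (rf_eval _) step => f step; split=> //; rewrite /= !step //; split.
  by rewrite w3u.
case=> [|[|[|m]]] //= _; rewrite !step // => -[] /inj ptE.
  by case/eqP: w_neq1; apply: (mulIf u_neq0); rewrite mul1r ptE.
by case/eqP: w_neq1; apply: (mulIf u_neq0); rewrite mul1r -[RHS]w3u ptE.
Qed.

Lemma period3_inv x : is_periodic (rf_eval (phi_normal v)) 3 (Some x) ->
  exists r s t, [/\ x = s^-1, t != s & [/\ v * (s * (1 - s)) * t = 1,
    v * (t * (1 - t)) * r = 1 & v * (r * (1 - r)) * s = 1]].
Proof.
have eval0 := rf_eval_normal0 v; have eval_infty := rf_eval_normal_infty v0.
move: (rf_eval _) eval0 eval_infty rf_eval_normal_inv => f f0 f_infty f_inv.
move=> [_ [/= cycle fix_n]].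
have x0 : x != 0 by apply: contra_eq_neq cycle => ->; rewrite f0 f_infty f0.
pose s := x^-1; have s0 : s != 0 by rewrite invr_eq0.
pose y := v * (s * (1 - s)); have fx : f (Some x) = Some y by rewrite -[x]invrK f_inv.
have y0 : y != 0.
  by apply: contra_eq_neq cycle => y0; rewrite fx y0 f0 f_infty; apply: contra_neq x0 => -[].
pose t := y^-1; have t0 : t != 0 by rewrite invr_eq0.
pose z := v * (t * (1 - t)); have fy : f (Some y) = Some z by rewrite -[y]invrK f_inv.
have z0 : z != 0 by apply: contra_eq_neq cycle => z0; rewrite fx fy z0 f0.
pose r := z^-1; have r0 : r != 0 by rewrite invr_eq0.
exists r, s, t; split; first by rewrite invrK.
  apply/eqP => /invr_inj yx; apply: (fix_n 1%N isT); by rewrite /= fx yx.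
rewrite -/y -/z !mulfV //; split=> //.
by move: cycle; rewrite fx fy -[z]invrK f_inv // => -[->]; rewrite mulfV.
Qed.

Lemma period3_cycle_pt w x : is_omega w ->
  is_periodic (rf_eval (phi_normal v)) 3 (Some x) ->
  exists2 w', w' = w \/ w' = w ^+ 2 &
    exists2 u, u ^+ 3 = cycle_cube v w' & x = cycle_pt w' u.
Proof.
move=> w1 /period3_inv[r [s [t [-> t_neq_s [s_step t_step r_step]]]]].
have [s0 t0 r0] : [/\ s != 0, t != 0 & r != 0].
  have neq0 (a b : F) : a * b = 1 -> b != 0.
    by apply: contra_eq_neq => ->; rewrite mulr0 eq_sym oner_eq0.
  by split; [exact: neq0 r_step | exact: neq0 s_step | exact: neq0 t_step].
have : (t - s) * ((t - 1) ^+ 2 + (t - 1) * s + s ^+ 2) = 0.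
  apply: (three_cycle_eq (r := r)).
    apply: (mulfI (mulf_neq0 v0 t0)); transitivity (v * (s * (1 - s)) * t); first by ring.
    by rewrite s_step -[LHS]t_step; ring.
  apply: (mulfI (mulf_neq0 v0 r0)); transitivity (v * (t * (1 - t)) * r); first by ring.
  by rewrite t_step -[LHS]r_step; ring.
have -> : (t - 1) ^+ 2 + (t - 1) * s + s ^+ 2 = (t - (1 + w * s)) * (t - (1 + w ^+ 2 * s)).
  by ring: (omega_sqr w1).
have rotation w' : is_omega w' -> t = 1 + w' * s ->
    exists2 u, u ^+ 3 = cycle_cube v w' & s^-1 = cycle_pt w' u.
  move=> w'1 tE; exists (1 - (1 - w') * s); last first.
    by rewrite -[s in RHS]invrK cycle_ptK ?invr_eq0 ?one_sub_omega_neq0.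
  rewrite rotation_cube // -tE /cycle_cube; congr (1 - _ * _).
  by apply: (mulfI v0); rewrite mulfV // -[RHS]s_step; ring.
move/eqP; rewrite !mulf_eq0 subr_eq0 (negPf t_neq_s) /= !subr_eq0 => /orP[] /eqP.
  by move/(rotation _ w1); exists w; first left.
by move/(rotation _ (is_omega_sqr w1)); exists (w ^+ 2); first right.
Qed.

End ThreeCycles.

(** * The field of 3-periodic points *)

Section EisensteinEvaluation.
Variables (R S : comNzRingType) (f : {rmorphism R -> S}) (w : S).

(* The argument w1 makes the ring morphism structure of eis_eval w1 inferrable. *)
Definition eis_eval (w1 : is_omega w) (z : eis R) : S := f z.1 + f z.2 * w.

Variable w1 : is_omega w.

Fact eis_eval_is_zmod_morphism : zmod_morphism (eis_eval w1).
Proof. by move=> x y; rewrite /eis_eval !rmorphB /=; ring. Qed.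
Fact eis_eval_is_monoid_morphism : monoid_morphism (eis_eval w1).
Proof.
split=> [|x y]; rewrite /eis_eval ?eisE; first by rewrite rmorph1 rmorph0; ring.
by rewrite !(rmorphB, rmorphD, rmorphM); ring: (omega_sqr w1).
Qed.
HB.instance Definition _ := GRing.isZmodMorphism.Build (eis R) S (eis_eval w1)
  eis_eval_is_zmod_morphism.
HB.instance Definition _ := GRing.isMonoidMorphism.Build (eis R) S (eis_eval w1)
  eis_eval_is_monoid_morphism.

Lemma eis_eval_const a : eis_eval w1 (Eis a 0) = f a.
Proof. by rewrite /eis_eval rmorph0 mul0r addr0. Qed.

Lemma eis_eval_conj z : eis_eval w1 (eis_conj z) = f z.1 + f z.2 * w ^+ 2.
Proof. by rewrite /eis_eval rmorphB rmorphN (omega_sqr w1); ring. Qed.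

End EisensteinEvaluation.

Lemma eis_eval_eq0 (R : realFieldType) (S : comNzRingType) (f : {rmorphism R -> S}) (w : S)
  (w1 : is_omega w) z : (eis_eval f w1 z == 0) = (z == 0).
Proof.
apply/eqP/eqP => [zE | ->]; last exact: rmorph0.
apply/eqP; rewrite -eis_norm_eq0 -(fmorph_eq0 f) -(eis_eval_const f w1) -eis_mul_conj.
by rewrite rmorphM /= zE mul0r.
Qed.

Lemma cycle_cubeE (F : fieldType) (f : {rmorphism rat -> F}) (v : rat) (w : F)
  (w1 : is_omega w) : cycle_cube (f v) w = eis_eval f w1 (cycle_resolvent v).
Proof.
by rewrite /cycle_cube /eis_eval /= rmorphB !fmorph_div rmorph1 !rmorph_nat; ring.
Qed.

Lemma cycle_cube_sqrE (F : fieldType) (f : {rmorphism rat -> F}) (v : rat) (w : F)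
  (w1 : is_omega w) : cycle_cube (f v) (w ^+ 2) = eis_eval f w1 (eis_conj (cycle_resolvent v)).
Proof. by rewrite (cycle_cubeE _ _ (is_omega_sqr w1)) eis_eval_conj. Qed.

Section Embedding.
Variables (L : splittingFieldType rat) (emb : {rmorphism L -> algC}).
Implicit Types (E K : {subfield L}) (P : option algC) (y z : algC) (v : rat).

Definition emb_in E z : Prop := exists2 x, x \in E & emb x = z.
Definition pt_in E P : Prop := if P is Some z then emb_in E z else True.

Lemma emb_in_rat E (r : rat) : emb_in E (ratr r).
Proof. by exists (ratr r); rewrite ?fmorph_rat // -alg_num_field memvZ ?mem1v. Qed.

Lemma emb_in_nat E n : emb_in E n%:R.
Proof. by rewrite -(ratr_nat _ n); apply: emb_in_rat. Qed.

Lemma emb_inB E y z : emb_in E y -> emb_in E z -> emb_in E (y - z).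
Proof. by move=> [a Ea <-] [b Eb <-]; exists (a - b); rewrite ?rpredB ?rmorphB. Qed.

Lemma emb_inD E y z : emb_in E y -> emb_in E z -> emb_in E (y + z).
Proof. by move=> [a Ea <-] [b Eb <-]; exists (a + b); rewrite ?rpredD ?rmorphD. Qed.

Lemma emb_inM E y z : emb_in E y -> emb_in E z -> emb_in E (y * z).
Proof. by move=> [a Ea <-] [b Eb <-]; exists (a * b); rewrite ?rpredM ?rmorphM. Qed.

Lemma emb_inX E y n : emb_in E y -> emb_in E (y ^+ n).
Proof. by move=> [a Ea <-]; exists (a ^+ n); rewrite ?rpredX ?rmorphXn. Qed.

Lemma emb_in_div E y z : emb_in E y -> emb_in E z -> emb_in E (y / z).
Proof. by move=> [a Ea <-] [b Eb <-]; exists (a / b); rewrite ?rpred_div ?fmorph_div. Qed.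

Lemma pt_in_moebius E (a b c e : rat) P : pt_in E P ->
  pt_in E (moebius (ratr a) (ratr b) (ratr c) (ratr e) P).
Proof.
move=> EP; have [Ex Ey] : emb_in E (ptx P) /\ emb_in E (pty P).
  have E0 : emb_in E 0 := emb_in_nat E 0; have E1 : emb_in E 1 := emb_in_nat E 1.
  by case: P EP.
rewrite /moebius /proj_pt; case: ifP => // _.
by apply: emb_in_div; apply: emb_inD; apply: emb_inM => //; apply: emb_in_rat.
Qed.

Lemma is_Q3field_conj (phi psi : rfun rat) K : is_rfun phi -> is_rfun psi ->
  rdeg psi = rdeg phi -> Qconj phi psi -> is_Q3field phi emb K -> is_Q3field psi emb K.
Proof.
move=> rf rf_psi deg [a [b [c [e lc]]]] [K_pts K_min].
pose rC : {rmorphism rat -> algC} := ratr.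
have lcC := lin_conj_by_map rC lc; have det := proj1 lcC.
have semi P : rf_eval (ratC phi) (moebius (rC a) (rC b) (rC c) (rC e) P) =
    moebius (rC a) (rC b) (rC c) (rC e) (rf_eval (ratC psi) P).
  by apply: rf_eval_lin_conj; rewrite ?(is_rfun_map rC) ?(rdeg_map rC).
have per P := is_periodic_semiconj 3 P (can_inj (moebiusK det)) semi.
split=> [z per_z | E E_pts].
  apply: (_ : pt_in K (Some z)); rewrite -(moebiusK det (Some z)) -!rmorphN.
  apply: pt_in_moebius; move/per: per_z; case: moebius => // y; exact: K_pts.
apply: K_min => z per_z; apply: (_ : pt_in E (Some z)); move: per_z.
rewrite -(moebiusVK det (Some z)) => /per per_z; apply: pt_in_moebius; move: per_z.
by case: moebius => // y; apply: E_pts.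
Qed.

Section Generators.
Variables (v : rat) (w a b : algC).
Local Notation rv := (ratr v).
Hypotheses (v0 : v != 0) (w1 : is_omega w).
Hypotheses (a3 : a ^+ 3 = cycle_cube rv w) (b3 : b ^+ 3 = cycle_cube rv (w ^+ 2)).

Let three0 : 3 != 0 :> algC. Proof. by rewrite pnatr_eq0. Qed.
Let rv0 : rv != 0 :> algC. Proof. by rewrite fmorph_eq0. Qed.
Let w1' : is_omega (w ^+ 2). Proof. exact: is_omega_sqr. Qed.
Let w_neq1 : 1 - w != 0. Proof. exact: one_sub_omega_neq0. Qed.
Let w2_neq1 : 1 - w ^+ 2 != 0. Proof. exact: one_sub_omega_neq0. Qed.

Lemma cycle_cube_neq0 : cycle_cube rv w != 0 /\ cycle_cube rv (w ^+ 2) != 0 :> algC.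
Proof.
rewrite (cycle_cubeE ratr v w1) (cycle_cubeE ratr v w1').
by rewrite !eis_eval_eq0 cycle_resolvent_neq0.
Qed.

Lemma period3_in_subfield E :
  (forall z, is_periodic (rf_eval (phi_normal rv)) 3 (Some z) -> emb_in E z) <->
  [/\ emb_in E w, emb_in E a & emb_in E b].
Proof.
have a0 : a != 0.
  by apply: contra_eq_neq a3 => ->; rewrite expr0n eq_sym; case: cycle_cube_neq0.
have b0 : b != 0.
  by apply: contra_eq_neq b3 => ->; rewrite expr0n eq_sym; case: cycle_cube_neq0.
have E1 := emb_in_nat E 1; split=> [E_pts | [Ew Ea Eb] z].
  have wa3 := cycle_cube_rot w1 a3.
  have [na nwa nb] : [/\ 1 - a != 0, 1 - w * a != 0 & 1 - b != 0].
    by split; [exact: cycle_cube_neq1 a3 | exact: cycle_cube_neq1 wa3 | exact: cycle_cube_neq1 b3].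
  have E_a := E_pts _ (cycle_pt_periodic three0 rv0 w1 a0 a3).
  have E_wa := E_pts _ (cycle_pt_periodic three0 rv0 w1 (mulf_neq0 (omega_neq0 w1) a0) wa3).
  have E_b := E_pts _ (cycle_pt_periodic three0 rv0 w1' b0 b3).
  have Ew : emb_in E w.
    rewrite (_ : w = cycle_pt w a / cycle_pt w (w * a) - cycle_pt w a).
      by apply: emb_inB => //; apply: emb_in_div.
    by rewrite /cycle_pt; field; rewrite na nwa.
  split=> //.
    by rewrite -(cycle_pt_coord w_neq1 na); apply: emb_inB E1 (emb_in_div (emb_inB E1 Ew) E_a).
  rewrite -(cycle_pt_coord w2_neq1 nb).
  exact: emb_inB E1 (emb_in_div (emb_inB E1 (emb_inX 2 Ew)) E_b).
have E_cycle_pt w' u u' : is_omega w' -> emb_in E w' -> emb_in E u' ->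
    u ^+ 3 = u' ^+ 3 -> emb_in E (cycle_pt w' u).
  move=> w'1 Ew' Eu' /(omega_orbit w'1)[i ->].
  exact: emb_in_div (emb_inB E1 Ew') (emb_inB E1 (emb_inM (emb_inX i Ew') Eu')).
case/(period3_cycle_pt three0 rv0 w1) => w' [] -> [u uE ->].
  by apply: E_cycle_pt Ew Ea _ => //; rewrite uE a3.
by apply: E_cycle_pt Eb _ => //; [apply: emb_inX | rewrite uE b3].
Qed.

End Generators.

Lemma algC_omega : exists w : algC, is_omega w.
Proof.
have [w w3] := @C_prim_root_exists 3 isT; exists w.
have w_neq1 : w - 1 != 0 by rewrite subr_eq0 -[w]expr1 -(prim_order_dvd w3).
apply: (mulfI w_neq1); rewrite mulr0; transitivity (w ^+ 3 - 1); first by ring.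
by rewrite (prim_expr_order w3) subrr.
Qed.

Lemma Q3field_gens (v : rat) K : v != 0 -> is_Q3field (phi_v v) emb K ->
  exists W A B (W1 : is_omega W), [/\ K = <<1 & [:: W; A; B]>>%VS :> {vspace L},
    A ^+ 3 = eis_eval (in_alg L) W1 (cycle_resolvent v) &
    B ^+ 3 = eis_eval (in_alg L) W1 (eis_conj (cycle_resolvent v))].
Proof.
move=> v0; have [w w1] := algC_omega; 
pose a := 3.-root (cycle_cube (ratr v) w); pose b := 3.-root (cycle_cube (ratr v) (w ^+ 2)).
have a3 : a ^+ 3 = cycle_cube (ratr v) w by rewrite rootCK.
have b3 : b ^+ 3 = cycle_cube (ratr v) (w ^+ 2) by rewrite rootCK.
rewrite /is_Q3field (_ : ratC (phi_v v) = phi_normal (ratr v)); last exact: (map_phi_normal ratr).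
have pts_in E := period3_in_subfield v0 w1 a3 b3 E.
move=> [/pts_in[[W KW WE] [A KA AE] [B KB BE]] K_min].
have W1 : is_omega W.
  by apply: (fmorph_inj emb); rewrite rmorph0 !rmorphD rmorphXn rmorph1 /= WE.
have embE (x : eis rat) : emb (eis_eval (in_alg L) W1 x) = eis_eval ratr w1 x.
  by rewrite rmorphD rmorphM /= !alg_num_field !fmorph_rat WE.
exists W, A, B, W1; split.
- apply/eqP; rewrite eqEsubv; apply/andP; split; last first.
    by apply/Fadjoin_seqP; split=> [|x]; rewrite ?sub1v // !inE => /or3P[] /eqP->.
  apply: (K_min <<1 & [:: W; A; B]>>%AS); apply/pts_in; split.
  + by exists W; rewrite ?seqv_sub_adjoin ?inE ?eqxx.
  + by exists A; rewrite ?seqv_sub_adjoin ?inE ?eqxx ?orbT.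
  + by exists B; rewrite ?seqv_sub_adjoin ?inE ?eqxx ?orbT.
- by apply: (fmorph_inj emb); rewrite embE rmorphXn /= AE a3 (cycle_cubeE ratr v w1).
- by apply: (fmorph_inj emb); rewrite embE rmorphXn /= BE b3 (cycle_cube_sqrE ratr v w1).
Qed.

End Embedding.

(** * Permutation groups of degree 6 *)

Lemma tperm_pt_val (a b : nat) (i : 'I_6) : (a.-1 < 6)%N -> (b.-1 < 6)%N ->
  tperm (pt a) (pt b) i = (if i == a.-1 :> nat then b.-1
    else if i == b.-1 :> nat then a.-1 else i) :> nat.
Proof.
move=> lt_a lt_b; rewrite permE /= -!val_eqE /= /pt !inordK //.
by case: ifP => _; [rewrite inordK | case: ifP => // _; rewrite inordK].
Qed.

Lemma gW_val (i : 'I_6) : gW i = nth 0%N [:: 1; 2; 0; 4; 5; 3]%N i :> nat.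
Proof. by rewrite /gW !permM !tperm_pt_val //; case: i => [[|[|[|[|[|[|]]]]]]]. Qed.

Lemma gC1_val (i : 'I_6) : gC1 i = nth 0%N [:: 5; 3; 4; 1; 2; 0]%N i :> nat.
Proof. by rewrite /gC1 !permM !tperm_pt_val //; case: i => [[|[|[|[|[|[|]]]]]]]. Qed.

Lemma gC2_val (i : 'I_6) : gC2 i = nth 0%N [:: 1; 2; 0; 5; 3; 4]%N i :> nat.
Proof. by rewrite /gC2 !permM !tperm_pt_val //; case: i => [[|[|[|[|[|[|]]]]]]]. Qed.

Lemma gW_orbit (i j : 'I_6) : (i < 3)%N = (j < 3)%N -> [\/ j = i, j = gW i | j = gW (gW i)].
Proof.
move=> block; suff: [|| j == i, j == gW i | j == gW (gW i)].
  by case/or3P=> /eqP; [apply: Or31 | apply: Or32 | apply: Or33].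
rewrite -!val_eqE /= !gW_val; move: block.
by case: i => [[|[|[|[|[|[|]]]]]]] //= _; case: j => [[|[|[|[|[|[|]]]]]]].
Qed.

Section WreathProduct.
Implicit Types (s t : {perm 'I_6}) (i j : 'I_6).

Lemma Wgrp_gW s i : s \in Wgrp -> s (gW i) = gW (s i).
Proof. by move=> /cent1P comm; rewrite -!permM comm. Qed.

Lemma Wgrp_gW_orbit s i j : s \in Wgrp -> (s i < 3)%N = (s j < 3)%N ->
  (i < 3)%N = (j < 3)%N.
Proof.
move=> sW /gW_orbit; rewrite -!Wgrp_gW // => -[] /perm_inj ->; rewrite ?gW_val //.
all: by case: i => [[|[|[|[|[|[|]]]]]]].
Qed.

Lemma Wgrp_eq s t i j : s \in Wgrp -> t \in Wgrp -> (i < 3)%N != (j < 3)%N ->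
  s i = t i -> s j = t j -> s = t.
Proof.
move=> sW tW ij eq_i eq_j; apply/permP => k.
have [/gW_orbit | /gW_orbit] : (i < 3)%N = (k < 3)%N \/ (j < 3)%N = (k < 3)%N.
- by move: ij; do 3!case: (_ < 3)%N; auto.
- by case=> ->; rewrite ?Wgrp_gW // eq_i.
- by case=> ->; rewrite ?Wgrp_gW // eq_j.
Qed.

Lemma card_Wgrp : (#|Wgrp| <= 18)%N.
Proof.
pose i : 'I_6 := inord 0; pose j : 'I_6 := inord 3.
have ij : (i < 3)%N != (j < 3)%N by rewrite !inordK.
pose f s : 'I_6 * 'I_3 := (s i, inord (s j %% 3)).
have <- : #|{: 'I_6 * 'I_3}| = 18%N by rewrite card_prod !card_ord.
rewrite -(card_in_imset (f := f)) ?max_card // => s t sW tW [eq_i /(congr1 val) /=].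
rewrite !inordK ?ltn_mod // => eq_j; apply: (Wgrp_eq sW tW ij) => //.
have block u : u \in Wgrp -> (u j < 3)%N = ~~ (u i < 3)%N.
  move=> uW; move: (contra_neq (@Wgrp_gW_orbit u i j uW) ij).
  by do 2!case: (_ < 3)%N.
have := block s sW; rewrite eq_i -block //; move: eq_j.
by case: (s j) => [[|[|[|[|[|[|]]]]]]] //= ls; case: (t j) => [[|[|[|[|[|[|]]]]]]] //= lt _ _;
  apply: val_inj.
Qed.

End WreathProduct.

(** * Galois groups of conjugate cubic Kummer extensions *)

Section ConjugateCubeRoots.
Variables (L : splittingFieldType rat) (K : {subfield L}) (W A B : L) (alpha : eis rat).
Hypothesis W1 : is_omega W.
Local Notation ev := (eis_eval (in_alg L) W1).
Hypothesis K_gen : K = <<1 & [:: W; A; B]>>%VS :> {vspace L}.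
Hypotheses (alpha2 : alpha.2 != 0) (A3 : A ^+ 3 = ev alpha) (B3 : B ^+ 3 = ev (eis_conj alpha)).
Implicit Types (x : gal_of K) (i : 'I_6) (b : bool) (z : L) (c : eis rat).
Local Notation G := ('Gal(K / 1%AS))%g.
Local Notation QW := <<1%VS; W>>%AS.
Local Notation N := ('Gal(K / QW))%g.

Let W2 : W ^+ 2 = - W - 1. Proof. exact: omega_sqr. Qed.
Let W0 : W != 0. Proof. exact: omega_neq0. Qed.

Let W_neq1 : W != 1.
Proof. by apply: omega_neq1 => //; rewrite -(rmorph_nat (in_alg L)) fmorph_eq0. Qed.

Let W_neq_sqr : W != W ^+ 2.
Proof. by apply: contra_neq W_neq1 => W_sqr; apply: (mulfI W0); rewrite mulr1 -expr2. Qed.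

Let KW : W \in K. Proof. by rewrite K_gen seqv_sub_adjoin ?inE ?eqxx. Qed.
Let KA : A \in K. Proof. by rewrite K_gen seqv_sub_adjoin ?inE ?eqxx ?orbT. Qed.
Let KB : B \in K. Proof. by rewrite K_gen seqv_sub_adjoin ?inE ?eqxx ?orbT. Qed.

Let alpha_neq0 : alpha != 0.
Proof. by apply: contraNneq alpha2 => ->. Qed.

Let A0 : A != 0.
Proof.
apply: contraNneq alpha_neq0 => A0.
by rewrite -(eis_eval_eq0 (in_alg L) W1) -A3 A0 expr0n.
Qed.

Let B0 : B != 0.
Proof.
apply: contraNneq alpha_neq0 => B0; rewrite -eis_norm_eq0 -eis_norm_conj eis_norm_eq0.
by rewrite -(eis_eval_eq0 (in_alg L) W1) -B3 B0 expr0n.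
Qed.

Lemma ev_inj : injective ev.
Proof.
by move=> c d /eqP; rewrite -subr_eq0 -rmorphB eis_eval_eq0 subr_eq0 => /eqP.
Qed.

Lemma ev_omega : ev (Eis 0 1) = W.
Proof. by rewrite /eis_eval rmorph0 rmorph1 mul1r add0r. Qed.

Lemma W_not_rat k : W <> in_alg L k.
Proof.
rewrite -ev_omega -(eis_eval_const (in_alg L) W1) => /ev_inj/(congr1 snd)/eqP.
by rewrite oner_eq0.
Qed.

Definition twisted_alpha b : eis rat := if b then alpha else eis_conj alpha.

Lemma twisted_alpha_inj : injective twisted_alpha.
Proof.
have neq : eis_conj alpha <> alpha by move/eqP; rewrite eis_conj_fixed (negPf alpha2).
by move=> [] [] //= eq_alpha; case: neq.
Qed.

Lemma twisted_alpha_conj b : eis_conj (twisted_alpha b) = twisted_alpha (~~ b).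
Proof. by case: b; rewrite //= eis_conjK. Qed.

Definition conj_roots : seq L := [:: A; W * A; W ^+ 2 * A; B; W ^+ 2 * B; W * B].
Definition conj_root i : L := conj_roots`_i.

Lemma conj_root_cube i : conj_root i ^+ 3 = ev (twisted_alpha (i < 3)%N).
Proof.
rewrite /conj_root; case: i => [[|[|[|[|[|[|]]]]]]] //= _; rewrite -?A3 -?B3; by ring: W2.
Qed.

Lemma conj_root_of_cube z b : z ^+ 3 = ev (twisted_alpha b) -> exists i, conj_root i = z.
Proof.
case: b; rewrite /twisted_alpha -?A3 -?B3 => /(omega_orbit W1)[[[|[|[|//]]] /= _] ->].
- by exists (inord 0); rewrite /conj_root inordK //= mul1r.
- by exists (inord 1); rewrite /conj_root inordK.
- by exists (inord 2); rewrite /conj_root inordK.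
- by exists (inord 3); rewrite /conj_root inordK //= mul1r.
- by exists (inord 5); rewrite /conj_root inordK.
- by exists (inord 4); rewrite /conj_root inordK.
Qed.

Lemma conj_root_inj : injective conj_root.
Proof.
have uniq_orbit z : z != 0 -> uniq [:: z; W * z; W ^+ 2 * z].
  move=> z0; have -> : [:: z; W * z; W ^+ 2 * z] = [seq y * z | y <- [:: 1; W; W ^+ 2]].
    by rewrite /= mul1r.
  rewrite (map_inj_uniq (mulIf z0)) /= !inE !negb_or W_neq_sqr !andbT eq_sym W_neq1 /=.
  by apply: contra_neq W_neq1 => W_sqr; rewrite -(omega_cube W1) exprS -W_sqr mulr1.
have uniq_roots : uniq conj_roots.
  rewrite -[conj_roots]/([:: A; W * A; W ^+ 2 * A] ++ [:: B; W ^+ 2 * B; W * B]) cat_uniq.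
  apply/and3P; split; first exact: uniq_orbit.
    apply/hasPn => z zB; apply/negP => zA.
    have : ev (twisted_alpha true) = ev (twisted_alpha false).
      transitivity (z ^+ 3).
        by move: zA; rewrite !inE => /or3P[] /eqP->; rewrite -A3; ring: W2.
      by move: zB; rewrite !inE => /or3P[] /eqP->; rewrite -B3; ring: W2.
    by move/ev_inj/twisted_alpha_inj.
  have := uniq_orbit _ B0; rewrite /= !inE !negb_or !andbT => /andP[/andP[-> ->]].
  by rewrite eq_sym => ->.
by move=> i j /eqP; rewrite /conj_root nth_uniq // => /eqP; exact: val_inj.
Qed.

Lemma prod_conj_roots : \prod_(z <- conj_roots) ('X - z%:P) =
  'X^6 - (ev (alpha + eis_conj alpha))%:P * 'X^3 + (ev (alpha * eis_conj alpha))%:P.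
Proof.
have -> : ev (alpha + eis_conj alpha) = A ^+ 3 + B ^+ 3 by rewrite A3 B3 -rmorphD.
have -> : ev (alpha * eis_conj alpha) = A ^+ 3 * B ^+ 3 by rewrite A3 B3 -rmorphM.
rewrite /conj_roots !big_cons big_nil mulr1.
have W2P : W%:P ^+ 2 = - W%:P - 1 :> {poly L} by rewrite -rmorphXn W2 rmorphB rmorphN rmorph1.
by ring: W2P.
Qed.

Lemma galois_conj_roots : galois 1 K.
Proof.
apply/and3P; split; [exact: sub1v | exact: separable_rat |].
apply/splitting_normalField; first exact: sub1v.
exists (\prod_(z <- conj_roots) ('X - z%:P)); last exists conj_roots; rewrite ?eqpxx //.
  have ev_rat (c : eis rat) : c.2 = 0 -> ev c \in 1%VS.
    by move=> c2; rewrite /eis_eval c2 rmorph0 mul0r addr0 rpredZ ?mem1v.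
  rewrite prod_conj_roots; apply: rpredD; last by rewrite polyOverC ev_rat // eis_mul_conj.
  apply: rpredB; first exact: polyOverXn.
  by apply: rpredM; rewrite ?polyOverXn // polyOverC ev_rat // eis_sndD /= addrN.
apply/eqP; rewrite eqEsubv; apply/andP; split.
  apply/Fadjoin_seqP; split; first exact: sub1v.
  by move=> z; rewrite !inE => /or3P[/eqP->|/eqP->|/or4P[] /eqP->]; rewrite ?rpredM ?rpredX.
have mem_roots z : z \in conj_roots -> z \in <<1 & conj_roots>>%VS by apply: seqv_sub_adjoin.
have [rA rWA rB] : [/\ A \in <<1 & conj_roots>>%VS, W * A \in <<1 & conj_roots>>%VS
    & B \in <<1 & conj_roots>>%VS].
  by split; apply: mem_roots; rewrite !inE eqxx ?orbT.
rewrite K_gen; apply/Fadjoin_seqP; split; first exact: sub1v.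
by move=> z; rewrite !inE => /or3P[] /eqP-> //; rewrite -(mulfK A0 W) rpred_div.
Qed.

Lemma mem_gal1 x : x \in G.
Proof. by rewrite gal_kHom ?sub1v // k1HomE ahomWin. Qed.

Lemma gal_W x : x W = W \/ x W = W ^+ 2.
Proof.
have: (x W - W) * (x W - W ^+ 2) = 0.
  have := is_omega_map x W1; rewrite /is_omega => <-; ring: W2.
by move/eqP; rewrite mulf_eq0 !subr_eq0 => /orP[] /eqP; [left | right].
Qed.

Lemma gal_ev x c : x (ev c) = ev (if x W == W then c else eis_conj c).
Proof.
have /= fix_rat r : x (in_alg L r) = in_alg L r by rewrite /= linearZ rmorph1.
rewrite {1}/eis_eval rmorphD rmorphM /= !fix_rat.
by case: (gal_W x) => ->; rewrite ?eqxx // eq_sym (negPf W_neq_sqr) eis_eval_conj.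
Qed.

Lemma gal_twisted_alpha x b :
  x (ev (twisted_alpha b)) = ev (twisted_alpha (b == (x W == W))).
Proof. by rewrite gal_ev; case: (x W == W); rewrite ?twisted_alpha_conj; case: b. Qed.

Lemma gal_conj_root x i : exists j, conj_root j = x (conj_root i).
Proof.
apply: (@conj_root_of_cube _ ((i < 3)%N == (x W == W))).
by rewrite -gal_twisted_alpha -conj_root_cube rmorphXn.
Qed.

Definition gal_perm_fun x i : 'I_6 := odflt ord0 [pick j | conj_root j == x (conj_root i)].

Lemma gal_perm_funE x i : conj_root (gal_perm_fun x i) = x (conj_root i).
Proof.
rewrite /gal_perm_fun; case: pickP => [j /eqP // | no_root].
by have [j jE] := gal_conj_root x i; have := no_root j; rewrite jE eqxx.
Qed.

Lemma gal_perm_fun_inj x : injective (gal_perm_fun x).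
Proof.
by move=> i j /(congr1 conj_root); rewrite !gal_perm_funE => /fmorph_inj/conj_root_inj.
Qed.

Definition gal_perm x : {perm 'I_6} := perm (@gal_perm_fun_inj x).

Lemma gal_permE x i : conj_root (gal_perm x i) = x (conj_root i).
Proof. by rewrite permE gal_perm_funE. Qed.

Lemma gal_permP x (s : {perm 'I_6}) :
  (forall i, x (conj_root i) = conj_root (s i)) -> gal_perm x = s.
Proof. by move=> xs; apply/permP => i; apply: conj_root_inj; rewrite gal_permE xs. Qed.

Lemma memv_conj_root i : conj_root i \in K.
Proof. by rewrite /conj_root; case: i => [[|[|[|[|[|[|]]]]]]] //= _; rewrite ?rpredM ?rpredX. Qed.

Lemma gal_permM : {in G &, {morph gal_perm : x y / (x * y)%g}}.
Proof.
move=> x y _ _; apply: gal_permP => i.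
by rewrite permM !gal_permE galM // memv_conj_root.
Qed.

Canonical gal_perm_morphism := Morphism gal_permM.

Lemma gal_eq1 x : x W = W -> x A = A -> x B = B -> x = 1%g.
Proof.
move=> xW xA xB; have: (K <= fixedField [set x])%VS.
  rewrite {1}K_gen; apply/Fadjoin_seqP; split; first exact: sub1v.
  by move=> z; rewrite !inE => /or3P[] /eqP->; apply/fixedFieldP => // y /set1P->.
move=> /subvP fixK; apply/eqP/gal_eqP => z /fixK/mem_fixedFieldP[_ fix_z].
by rewrite gal_id fix_z ?set11.
Qed.

Lemma injm_gal_perm : ('injm gal_perm_morphism)%g.
Proof.
apply/subsetP => x /mker /= perm1E; apply/set1P.
have fix_root i : x (conj_root i) = conj_root i by rewrite -gal_permE perm1E perm1.
have xA : x A = A by have := fix_root (inord 0); rewrite /conj_root inordK.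
have xB : x B = B by have := fix_root (inord 3); rewrite /conj_root inordK.
apply: gal_eq1 => //; have := fix_root (inord 1); rewrite /conj_root inordK //= rmorphM /= xA.
exact: mulIf.
Qed.

Lemma gal_perm_isog (H : {set {perm 'I_6}}) : (gal_perm_morphism @* G)%g = H -> (G \isog H)%g.
Proof. by move=> <-; apply: sub_isog injm_gal_perm. Qed.

Lemma gal_perm_block x i : (gal_perm x i < 3)%N = ((i < 3)%N == (x W == W)).
Proof.
apply/twisted_alpha_inj/ev_inj.
by rewrite -gal_twisted_alpha -!conj_root_cube gal_permE rmorphXn.
Qed.

Lemma conj_root_gW i : conj_root (gW i) = (if (i < 3)%N then W else W ^+ 2) * conj_root i.
Proof.
by rewrite /conj_root gW_val; case: i => [[|[|[|[|[|[|]]]]]]] //= _; ring: W2.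
Qed.

Lemma gal_perm_sub_Wgrp : (gal_perm_morphism @* G \subset Wgrp)%g.
Proof.
apply/subsetP => _ /morphimP[x _ _ ->]; apply/cent1P/permP => i.
rewrite [LHS]permM [RHS]permM; apply: conj_root_inj.
rewrite conj_root_gW [RHS]gal_permE conj_root_gW rmorphM /= !gal_permE gal_perm_block.
congr (_ * _); case: (gal_W x) => xW; rewrite xW ?eqxx.
  by case: (i < 3)%N; rewrite ?rmorphXn /= xW.
rewrite [W ^+ 2 == W]eq_sym (negPf W_neq_sqr).
by case: (i < 3)%N; rewrite ?rmorphXn /= xW //; ring: W2.
Qed.

Let sub_QW_K : (QW <= K)%VS.
Proof. by apply/FadjoinP; rewrite sub1v. Qed.

Lemma mem_galN x : (x \in N) = (x W == W).
Proof.
apply/idP/eqP => [xN | xW]; first by apply: (fixed_gal sub_QW_K xN); rewrite memv_adjoin.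
have: x \in 'Gal(K / fixedField [set x])%g by rewrite gal_generated mem_gen ?set11.
apply/subsetP/galS/FadjoinP; split; first exact: sub1v.
by apply/fixedFieldP => // y /set1P->.
Qed.

Lemma fixedField_galN z : z \in K -> (forall x, x \in N -> x z = z) -> exists c, z = ev c.
Proof.
move=> Kz fix_z; have galQW : galois QW K by apply: galoisS galois_conj_roots; rewrite sub1v.
have: z \in fixedField N by apply/fixedFieldP.
move/galois_fixedField: galQW => -> /Fadjoin_polyP[p /polyOverP p1 ->].
rewrite horner_coef; apply: (big_ind (fun y => exists c, y = ev c)).
- by exists 0; rewrite rmorph0.
- by move=> _ _ [c ->] [d ->]; exists (c + d); rewrite rmorphD.
move=> i _; have /vlineP[k ->] := p1 i.
by exists (Eis k 0 * Eis 0 1 ^+ i); rewrite rmorphM rmorphXn /= ev_omega eis_eval_const.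
Qed.

Lemma gal_swap_exists : exists x, x W = W ^+ 2.
Proof.
have [x /eqP xW | no_swap] := pickP (fun x : gal_of K => x W == W ^+ 2); first by exists x.
have: W \in fixedField G.
  by apply/fixedFieldP => // x _; case: (gal_W x) (no_swap x) => ->; rewrite ?eqxx.
by move/galois_fixedField: galois_conj_roots => -> /vlineP[k /W_not_rat].
Qed.

Lemma galN_A x : x W = W -> exists i : 'I_3, x A = W ^+ i * A.
Proof.
move=> xW; apply: omega_orbit => //.
by rewrite -rmorphXn /= A3 gal_ev xW eqxx.
Qed.

Lemma galN_B x : x W = W -> exists i : 'I_3, x B = W ^+ i * B.
Proof.
move=> xW; apply: omega_orbit => //.
by rewrite -rmorphXn /= B3 gal_ev xW eqxx.
Qed.

Lemma galN_expg x z k n : x W = W -> z \in K -> x z = W ^+ k * z ->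
  (x ^+ n)%g z = W ^+ (k * n) * z.
Proof.
move=> xW Kz xz; elim: n => [|n IH]; first by rewrite muln0 mul1r gal_id.
by rewrite expgSr galM // IH rmorphM rmorphXn /= xW xz mulrA -exprD mulnS addnC.
Qed.

Lemma galN_pgroup : pgroup 3%N N.
Proof.
apply/pgroupP => p pr_p /Cauchy[] // x; rewrite mem_galN => /eqP xW ord_x.
have [i xA] := galN_A xW; have [j xB] := galN_B xW.
have W3 k : W ^+ (k * 3) = 1 by rewrite mulnC exprM omega_cube ?expr1n.
have x3 : (x ^+ 3 = 1)%g.
  apply: gal_eq1; rewrite ?(galN_expg 3 xW KA xA) ?(galN_expg 3 xW KB xB) ?W3 ?mul1r //.
  by rewrite (galN_expg (k := 0) 3 xW KW) ?mul1r.
have: (p %| 3)%N by rewrite -ord_x order_dvdn x3.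
by rewrite dvdn_prime2 // => /eqP->; rewrite inE.
Qed.

Section NormNotCube.
Hypothesis norm_not_cube : forall y : rat, y ^+ 3 != eis_norm alpha.

Let norm_eq_absurd c d : c ^+ 3 = d -> eis_norm d = eis_norm alpha -> False.
Proof.
by move=> <- /eqP; rewrite eis_normX (negPf (norm_not_cube _)).
Qed.

Let A_not_ev c : A <> ev c.
Proof.
move=> AE; have : ev (c ^+ 3) = ev alpha by rewrite rmorphXn /= -AE.
by move/ev_inj/norm_eq_absurd; apply.
Qed.

Let B_not_ev c : B <> ev c.
Proof.
move=> BE; have : ev (c ^+ 3) = ev (eis_conj alpha) by rewrite rmorphXn /= -BE.
by move/ev_inj/norm_eq_absurd; apply; rewrite eis_norm_conj.
Qed.

Let AB_not_ev c : A * B <> ev c.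
Proof.
move=> ABE; have : ev (c ^+ 3) = ev (Eis (eis_norm alpha) 0).
  by rewrite rmorphXn /= -ABE exprMn A3 B3 -rmorphM eis_mul_conj.
by case/ev_inj/eis_cube_const => y /eqP; rewrite (negPf (norm_not_cube _)).
Qed.

(* A generator of a cyclic N would fix A, B, A / B or A B. *)
Lemma galN_not_cyclic :
  (forall c, alpha <> eis_conj alpha * c ^+ 3) -> ~~ (cyclic N)%g.
Proof.
move=> not_quotient; apply/negP => /cyclicP[x Nx].
have xN : x \in N by rewrite Nx cycle_id.
have xW : x W = W by apply/eqP; rewrite -mem_galN.
have fix_ev z : z \in K -> x z = z -> exists c, z = ev c.
  move=> Kz xz; apply: fixedField_galN => // y; rewrite Nx => /cycleP[k ->].
  by rewrite (galN_expg (k := 0) k xW Kz) ?mul1r.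
have xA : x A <> A by case/(fix_ev _ KA) => c /A_not_ev.
have xB : x B <> B by case/(fix_ev _ KB) => c /B_not_ev.
have xAB : x (A * B) <> A * B.
  by case/(fix_ev _ (rpredM KA KB)) => c /AB_not_ev.
have xAVB : x (A / B) <> A / B.
  case/(fix_ev _ (rpred_div KA KB)) => c ABE; apply: (not_quotient c); apply: ev_inj.
  by rewrite rmorphM rmorphXn /= -ABE expr_div_n A3 B3 mulrC divfK // -B3 expf_neq0.
have [i xAE] := galN_A xW; have [j xBE] := galN_B xW.
move: xA xB xAB xAVB; rewrite rmorphM fmorph_div /= xAE xBE.
case: i j {xAE xBE} => [[|[|[|//]]] /= _] [[|[|[|//]]] /= _];
  rewrite ?expr0 ?mul1r // => _ _ xAB xAVB.
- by apply: xAVB; field; rewrite W0 B0.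
- by apply: xAB; ring: W2.
- by apply: xAB; ring: W2.
- by apply: xAVB; field; rewrite W0 B0.
Qed.

Lemma gal_perm_generic : (forall c, alpha <> eis_conj alpha * c ^+ 3) ->
  (gal_perm_morphism @* G)%g = Wgrp.
Proof.
move=> not_quotient; apply/eqP; rewrite eqEcard gal_perm_sub_Wgrp /=.
rewrite card_injm ?injm_gal_perm //; apply: leq_trans card_Wgrp _.
have sub_NG : N \subset G by apply/subsetP => x _; apply: mem_gal1.
have [k cardN] := p_natP galN_pgroup.
have k_gt1 : (1 < k)%N.
  rewrite ltnNge; apply: contra (galN_not_cyclic not_quotient).
  case: k cardN => [|[|//]] cardN _; last by apply: prime_cyclic; rewrite cardN.
  by have /eqP := cardN; rewrite expn0 -trivg_card1 => /eqP->; exact: cyclic1.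
rewrite -(Lagrange sub_NG) cardN -[18%N]/(9 * 2)%N leq_mul //; first by rewrite (@leq_exp2l 3 2 k).
rewrite indexg_gt1; apply/subsetPn; have [x xW] := gal_swap_exists.
by exists x; rewrite ?mem_gal1 // mem_galN xW eq_sym.
Qed.

Section ConjugateQuotient.
Variable c : eis rat.
Hypotheses (c0 : c != 0) (AB : B * ev (eis_conj c) = A * ev c).

Let ev_c0 : ev c != 0. Proof. by rewrite eis_eval_eq0. Qed.

Let ev_conj_c0 : ev (eis_conj c) != 0.
Proof. by rewrite eis_eval_eq0 -eis_norm_eq0 eis_norm_conj eis_norm_eq0. Qed.

Lemma conj_root_gC2X n i : conj_root ((gC2 ^+ n)%g i) = W ^+ n * conj_root i.
Proof.
have conj_root_gC2 j : conj_root (gC2 j) = W * conj_root j.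
  by rewrite /conj_root gC2_val; case: j => [[|[|[|[|[|[|]]]]]]] //= _; ring: W2.
elim: n i => [|n IH] i; first by rewrite expg0 perm1 mul1r.
by rewrite expgSr permM conj_root_gC2 IH exprS mulrA.
Qed.

Lemma gal_perm_galN x (n : nat) : x W = W -> x A = W ^+ n * A -> gal_perm x = (gC2 ^+ n)%g.
Proof.
move=> xW xA; have xB : x B = W ^+ n * B.
  apply: (mulIf ev_conj_c0); have := congr1 x AB.
  by rewrite !rmorphM /= !gal_ev xW eqxx xA -!mulrA AB => ->.
apply: gal_permP => i; rewrite conj_root_gC2X /conj_root.
by case: i => [[|[|[|[|[|[|]]]]]]] //= _; rewrite ?(rmorphM, rmorphXn) /= ?xW ?xA ?xB; ring.
Qed.

Lemma gal_perm_swap x : x W = W ^+ 2 -> exists n, gal_perm x = (gC1 * gC2 ^+ n)%g.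
Proof.
move=> xW; have x_conj d : x (ev d) = ev (eis_conj d).
  by rewrite gal_ev xW eq_sym (negPf W_neq_sqr).
have [k xA] : exists k : 'I_3, x A = W ^+ k * B.
  by apply: omega_orbit => //; rewrite -rmorphXn /= A3 x_conj B3.
have xB : x B = W ^+ k * A.
  apply: (mulIf ev_c0); have := congr1 x AB.
  by rewrite !rmorphM /= !x_conj eis_conjK xA -!mulrA AB => ->.
exists (k + 2)%N; apply: gal_permP => i; rewrite permM conj_root_gC2X /conj_root gC1_val exprD.
by case: i => [[|[|[|[|[|[|]]]]]]] //= _;
  rewrite ?(rmorphM, rmorphXn) /= ?xW ?xA ?xB; ring: W2.
Qed.

Lemma gal_perm_conj_quotient : (gal_perm_morphism @* G)%g = Cgrp.
Proof.
have gC2X4 : (gC2 ^+ 2 ^+ 2 = gC2)%g.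
  apply/permP => i; apply: conj_root_inj; rewrite -expgM conj_root_gC2X -[gC2 in RHS]expg1.
  by rewrite conj_root_gC2X; ring: W2.
have mem_img x : gal_perm x \in (gal_perm_morphism @* G)%g.
  by apply: (mem_morphim gal_perm_morphism); apply: mem_gal1.
have gC2_img : gC2 \in (gal_perm_morphism @* G)%g.
  have [x /andP[/eqP xW /eqP xA] | fix_A] := pickP (fun x : gal_of K => (x W == W) && (x A != A)).
    have [i xAE] := galN_A xW; have := mem_img x; rewrite (gal_perm_galN xW xAE).
    case: i xAE => [[|[|[|//]]] /= _] xAE; first by case: xA; rewrite xAE mul1r.
      by rewrite expg1.
    by move=> img; rewrite -gC2X4 groupX.
  have [x|d /A_not_ev//] := fixedField_galN KA.
  by rewrite mem_galN => xW; apply/eqP; move: (fix_A x); rewrite xW /= => /negbFE.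
apply/eqP; rewrite eqEsubset gen_subG; apply/andP; split.
  have gC1_gen : gC1 \in Cgrp by rewrite mem_gen // set21.
  have gC2_gen : gC2 \in Cgrp by rewrite mem_gen // set22.
  apply/subsetP => _ /morphimP[x _ _ ->] /=; case: (gal_W x) => xW.
    by have [i xA] := galN_A xW; rewrite (gal_perm_galN xW xA) groupX.
  by have [n ->] := gal_perm_swap xW; rewrite groupM ?groupX.
rewrite subUset !sub1set gC2_img andbT; have [x xW] := gal_swap_exists.
by have [n xE] := gal_perm_swap xW; have := mem_img x; rewrite xE groupMr // groupX.
Qed.

End ConjugateQuotient.

End NormNotCube.

End ConjugateCubeRoots.

Lemma gal_isog_Wgrp (L : splittingFieldType rat) (K : {subfield L}) (W A B : L) (alpha : eis rat)
    (W1 : is_omega W) :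
  K = <<1 & [:: W; A; B]>>%VS :> {vspace L} -> alpha.2 != 0 ->
  A ^+ 3 = eis_eval (in_alg L) W1 alpha -> B ^+ 3 = eis_eval (in_alg L) W1 (eis_conj alpha) ->
  (forall y : rat, y ^+ 3 != eis_norm alpha) ->
  (forall c, alpha <> eis_conj alpha * c ^+ 3) -> ('Gal(K / 1%AS) \isog Wgrp)%g.
Proof.
move=> K_gen alpha2 A3 B3 norm_not_cube not_quotient.
exact: gal_perm_isog (gal_perm_generic K_gen alpha2 A3 B3 norm_not_cube not_quotient).
Qed.

Lemma adjoin_cube_root (L : splittingFieldType rat) (W A B B' : L) : is_omega W ->
  B ^+ 3 = B' ^+ 3 -> <<1 & [:: W; A; B]>>%VS = <<1 & [:: W; A; B']>>%VS :> {vspace L}.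
Proof.
move=> W1 cubeE; have sub_gen C D : C ^+ 3 = D ^+ 3 ->
    (<<1 & [:: W; A; C]>> <= <<1 & [:: W; A; D]>>)%VS.
  move=> /(omega_orbit W1)[i ->]; set E := <<1 & [:: W; A; D]>>%AS.
  have [EW EA ED] : [/\ W \in E, A \in E & D \in E].
    by split; rewrite seqv_sub_adjoin ?inE ?eqxx ?orbT.
  apply/Fadjoin_seqP; split=> [|z]; first exact: sub1v.
  by rewrite !inE => /or3P[] /eqP->; rewrite ?rpredM ?rpredX.
by apply/eqP; rewrite eqEsubv !sub_gen.
Qed.

(* B can be replaced by A c / conj c, which has the same cube. *)
Lemma gal_isog_Cgrp (L : splittingFieldType rat) (K : {subfield L}) (W A B : L) (alpha c : eis rat)
    (W1 : is_omega W) :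
  K = <<1 & [:: W; A; B]>>%VS :> {vspace L} -> alpha.2 != 0 ->
  A ^+ 3 = eis_eval (in_alg L) W1 alpha -> B ^+ 3 = eis_eval (in_alg L) W1 (eis_conj alpha) ->
  (forall y : rat, y ^+ 3 != eis_norm alpha) ->
  c != 0 -> (alpha * c ^+ 3).2 = 0 -> ('Gal(K / 1%AS) \isog Cgrp)%g.
Proof.
move=> K_gen alpha2 A3 B3 norm_not_cube c0 /eqP; rewrite -eis_conj_fixed => /eqP twist.
pose ev := eis_eval (in_alg L) W1; have ev_conj_c0 : ev (eis_conj c) != 0.
  by rewrite eis_eval_eq0 -eis_norm_eq0 eis_norm_conj eis_norm_eq0.
pose B' := A * ev c / ev (eis_conj c).
have B'E : B' * ev (eis_conj c) = A * ev c by rewrite divfK.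
have B'3 : B' ^+ 3 = ev (eis_conj alpha).
  apply: (mulIf (expf_neq0 3 ev_conj_c0)); rewrite -exprMn B'E exprMn A3.
  by rewrite /ev -!rmorphXn -!rmorphM /= twist.
have K_gen' : K = <<1 & [:: W; A; B']>>%VS :> {vspace L}.
  by rewrite K_gen; apply: adjoin_cube_root => //; rewrite B'3 B3.
exact: gal_perm_isog (gal_perm_conj_quotient K_gen' alpha2 A3 B'3 norm_not_cube c0 B'E).
Qed.

(** * The dynatomic group *)

Lemma gal_Q3field (v : rat) (L : splittingFieldType rat) (emb : {rmorphism L -> algC})
    (K : {subfield L}) : v != 0 -> v != 3 -> is_Q3field (phi_v v) emb K ->
  (in_eta v -> ('Gal(K / 1%AS) \isog Cgrp)%g) /\
  (~ in_eta v -> ('Gal(K / 1%AS) \isog Wgrp)%g).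
Proof.
move=> v0 v3 /(Q3field_gens v0)[W [A [B [W1 [K_gen A3 B3]]]]].
have norm_not_cube y := cycle_resolvent_norm_not_cube v0 y v3.
have alpha2 := cycle_resolvent_snd_neq0 v0.
split=> [/(twist_of_in_eta v0)[c c0 twist] | not_eta].
  exact: gal_isog_Cgrp K_gen alpha2 A3 B3 norm_not_cube c0 twist.
apply: gal_isog_Wgrp K_gen alpha2 A3 B3 norm_not_cube _ => c.
by move/(in_eta_of_conj_quotient v0).
Qed.

Theorem theorem1p1 (phi : rfun rat) :
  is_rfun phi -> rdeg phi = 2%N ->
  (exists P : option algC,
      is_critical (ratC phi) P /\ is_periodic (rf_eval (ratC phi)) 2 P) ->
  aut_trivial (ratC phi) ->
  (exists2 v : rat, v != 0 & Qconj phi (phi_v v)) /\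
  (forall v : rat, v != 0 -> Qconj phi (phi_v v) -> v != 3 ->
     forall (L : splittingFieldType rat) (emb : {rmorphism L -> algC})
            (K : {subfield L}),
       is_Q3field phi emb K ->
       (in_eta v -> ('Gal(K / 1%AS) \isog Cgrp)%g) /\
       (~ in_eta v -> ('Gal(K / 1%AS) \isog Wgrp)%g)).
Proof.
move=> rf deg2 crit triv; split; first exact: Qconj_phi_v_exists.
move=> v v0 conj v3 L emb K K_Q3; apply: (gal_Q3field v0 v3 (emb := emb)).
apply: is_Q3field_conj rf _ _ conj K_Q3; first exact: is_rfun_normal.
by rewrite deg2; exact: rdeg_normal.
Qed.
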